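(* Let $H$ be an initial-closed graph with $\mu(H)=(\mu_1,\ldots,\mu_s,0,\ldots,0)\in\mathbb N^{n-1}$, where $1\le s\le n-3$. If $0<\mu_s<\cdots<\mu_1<n-s$, then $\beta_{2(n-1)-(\mu_s+s),\;2(n-1)-(\mu_s+s)+3}(H)$ is the unique extremal Betti number of $H$.
   Context: A graph $G$ on $\{1,\ldots,n\}$ (finite, simple) is closed (with respect to this labelling) if whenever $\{i,j\},\{i,k\}$ ($j\ne k$) are edges with either $i<j,i<k$ or $i>j,i>k$, then $\{j,k\}$ is an edge. A cut point of a connected graph is a vertex whose removal disconnects it. Let $G$ be a connected closed graph on $\{1,\ldots,n\}$, $n\ge2$, without cut point. Its initial-closed graph $H$ is the (connected, bipartite) graph with vertices $x_1,\ldots,x_{n-1}$ and (after renaming $y_j$ as $y_{j-1}$) $y_1,\ldots,y_{n-1}$, where $x_i$ is adjacent to $y_{j-1}$ iff $i<j$ and $\{i,j\}\in E(G)$. Put $\mu(H)=(\mu_1,\ldots,\mu_{n-1})$, $\mu_i:=n-i-\deg_H(x_i)$. Then $\mu_1\ge\cdots\ge\mu_{n-1}=0$ (with $\mu_{n-2}=0$ when $n\ge3$), $\mu_i\le n-2-i$ for $1\le i\le n-3$, and the edge ideal of $H$ is $I(H)=(x_iy_j\mid 1\le i\le n-1,\ i\le j\le n-1-\mu_i)$. For a graph $H$ and a fixed field $\Bbbk$, $\beta_{i,j}(H)$ denotes the graded Betti number $\beta_{i,j}(\Bbbk[V(H)]/I(H))$. A Betti number $\beta_{i,j}(H)\neq0$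 is extremal if $\beta_{l,r}(H)=0$ for all $l\ge i$, $r\ge j+1$ with $r-l\ge j-i$.
   Formalization: The case s = 1 is excluded (the chain is read as including μ_s < μ_1), because the claim fails there: for n = 4, μ(H) = (1,0,0), H is a path on six vertices and β_{4,7}(H) = 0; for s = 1 the regularity is always at most 2. *)

(* Defs.v *)
From HB Require Import structures.
From mathcomp Require Import all_boot all_order all_algebra.
From mathcomp Require Export mpoly.
Set Implicit Arguments.
Unset Strict Implicit.
Unset Printing Implicit Defensive.

Import GRing.Theory.

(* A finite simple graph on a finite type T is a symmetric irreflexive
   relation on T. *)

Definition simple_graph (T : finType) (e : rel T) : Prop :=
  ssrbool.symmetric e /\ irreflexive e.

Definition connected_graph (T : finType) (e : rel T) : Prop :=
  forall u v : T, connect e u v.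

Definition remove_vertex (T : finType) (e : rel T) (v : T) : rel T :=
  fun a b => [&& e a b, a != v & b != v].

Definition cut_point (T : finType) (e : rel T) (v : T) : Prop :=
  exists a b : T, [/\ a != v, b != v & ~~ connect (remove_vertex e v) a b].

Definition degree (T : finType) (e : rel T) (v : T) : nat := #|[set w | e v w]|.

(* The vertices 1, ..., n are represented by 'I_n = {0, ..., n-1}. *)
Definition closed_graph (n : nat) (e : rel 'I_n) : Prop :=
  forall i j k : 'I_n, j != k -> e i j -> e i k ->
    (i < j) && (i < k) || (j < i) && (k < i) -> e j k.

(* The vertex set {x_1, ..., x_m, y_1, ..., y_m} is 'I_(m + m); with indices
   from 0, x_(a+1) is [vx a] and y_(b+1) is [vy b]. *)
Definition vx (m : nat) (a : 'I_m) : 'I_(m + m) := lshift m a.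
Definition vy (m : nat) (b : 'I_m) : 'I_(m + m) := rshift m b.

(* In 1-based terms x_i ~ y_(j-1) iff i < j and {i, j} is an edge of G.  With
   i = a+1 and j = b+2, the vertices i and j of G are the elements of 'I_n of
   value a and b+1. *)
Definition initial_xy (n : nat) (e : rel 'I_n) (a b : 'I_n.-1) : bool :=
  [exists i : 'I_n, exists j : 'I_n,
    [&& i == a :> nat, j == b.+1 :> nat, i < j & e i j]].

Definition initial_closed_graph (n : nat) (e : rel 'I_n) :
    rel 'I_(n.-1 + n.-1) :=
  fun u v =>
    match split u, split v with
    | inl a, inr b => initial_xy e a b
    | inr b, inl a => initial_xy e a b
    | _, _ => false
    end.

(* mu_i = n - i - deg x_i with i = a+1; the truncated subtraction is harmless,
   as x_i has at most n - i neighbours in an initial-closed graph. *)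
Definition mu_entry (n : nat) (h : rel 'I_(n.-1 + n.-1)) (a : 'I_n.-1) : nat :=
  n - a.+1 - degree h (vx a).

Section GradedResolutions.
Variables (k : fieldType) (N : nat).
Local Notation S := {mpoly k[N]}.
Local Open Scope ring_scope.

Definition edge_ideal (e : rel 'I_N) (f : S) : Prop :=
  exists c : 'I_N -> 'I_N -> S,
    f = \sum_(p : 'I_N * 'I_N | e p.1 p.2) c p.1 p.2 * ('X_p.1 * 'X_p.2).

(* A minimal graded free resolution
     ... -> F_2 -> F_1 -> F_0 -> S/I -> 0
   with F_i = \bigoplus_a S(- fdeg i a) of finite rank [frank i]; elements of
   F_i are row vectors, and row a of [fdiff i] is the image in F_i of the basis
   element a of F_(i+1).  The augmentation F_0 -> S/I is given by homogeneous
   representatives in S of the images of the basis elements.  Natural-number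
   shifts suffice, since S/I lives in nonnegative degrees. *)
Record min_graded_free_resolution (I : S -> Prop) := MinGradedFreeResolution {
  frank : nat -> nat;
  fdeg : forall i, 'I_(frank i) -> nat;
  fdiff : forall i, 'M[S]_(frank i.+1, frank i);
  faug : 'cV[S]_(frank 0);
  fdiff_graded : forall i a b m,
    m \in msupp (fdiff i a b) -> (mdeg m + fdeg b)%N = fdeg a;
  faug_graded : forall a m, m \in msupp (faug a 0) -> mdeg m = fdeg a;
  faug_surjective : forall f : S,
    exists v : 'rV[S]_(frank 0), I (f - (v *m faug) 0 0);
  faug_exact : forall v : 'rV[S]_(frank 0),
    I ((v *m faug) 0 0) <-> exists w : 'rV[S]_(frank 1), v = w *m fdiff 0;
  fdiff_exact : forall i (v : 'rV[S]_(frank i.+1)),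
    v *m fdiff i = 0 <-> exists w : 'rV[S]_(frank i.+2), v = w *m fdiff i.+1;
  (* the image of F_(i+1) lies in (X_1, ..., X_N) F_i *)
  fdiff_minimal : forall i a b, (fdiff i a b)@_0%MM = 0
}.

(* The graded Betti number beta_(i, j) of S/I: the multiplicity of S(-j) in
   the i-th module of a minimal graded free resolution of S/I.  It does not
   depend on the choice of the resolution. *)
Definition graded_betti (I : S -> Prop) (F : min_graded_free_resolution I)
    (i j : nat) : nat :=
  #|[set a : 'I_(frank F i) | fdeg a == j]|.

End GradedResolutions.

(* [j + l <= r + i] is the condition r - l >= j - i, free of truncation. *)
Definition extremal_betti (beta : nat -> nat -> nat) (i j : nat) : Prop :=
  beta i j <> 0 /\
  forall l r : nat, i <= l -> j.+1 <= r -> j + l <= r + i -> beta l r = 0.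

Definition unique_extremal_betti (beta : nat -> nat -> nat) (i j : nat) : Prop :=
  extremal_betti beta i j /\
  forall i' j' : nat, extremal_betti beta i' j' -> i' = i /\ j' = j.

(* Main.v *)
Require Import Defs.
From mathcomp Require Import all_boot all_order all_algebra.
From mathcomp Require Import zify.
Set Implicit Arguments.
Unset Strict Implicit.
Unset Printing Implicit Defensive.
Import GRing.Theory.

(** Put m = n - 1.  Vertices are counted from 0 and the entries of mu from 1, so
    let t a = m - mu_(a+1), where mu_(a+1) = 0 for a >= s.  Since G is connected
    and closed, H is a staircase: x_a is adjacent to y_b exactly when
    a <= b < t a ([initial_mu]), and t is nondecreasing.  With
    p = 2 m - (mu_s + s) it is enough to prove two facts
    ([extremal_of_corner]): every nonzero beta_(i, j) has i <= p and
    j <= i + 3, and beta_(p, p + 3) is nonzero.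

    Both are read off the Koszul homology of S/I(H).  A generator of degree j
    of the i-th module of the resolution corresponds to a nonzero class of
    degree j in the i-th Koszul homology; the passage goes through the syzygy
    modules, one dimension shift at a time ([betti_eq0] and
    [betti_eq0_acyclic]).  The Koszul complex of a quotient by a monomial ideal
    splits into multidegrees ([koszul_lift]).  A multidegree with an exponent
    at least 2 contributes nothing, and a squarefree one, with support W,
    contributes the reduced cohomology of the complex of independent sets of
    the graph induced on W ([strand_acyclic]); this is the formula of Hochster.
    Thus beta_(i, j) is nonzero exactly when, for some W of cardinal j, there is
    a nonzero class carried by independent sets of cardinal c = j - i.

    Two moves compute this cohomology: it vanishes when W has an isolated
    vertex, and a vertex v can be split into its deletion and its link.  They
    allow one to delete a vertex whose neighbourhood contains that of a
    nonadjacent vertex, and to replace W by the non-neighbours of x when some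
    vertex has x as its only neighbour.  In a staircase, let x_a and y_j be the
    first vertices of each kind in W.  Every other x_i with i <= j dominates
    x_a and can be deleted; then y_j is a leaf at x_a.  What remains is formed
    by the x_i with i > j and the y_b with b >= t a, so at most t a - a + 1
    vertices are lost while c drops by one ([staircase_step]).  Such a step
    needs a remaining y_b, which excludes a fourth one; so if the cohomology of
    W is nonzero, then W is exhausted after c <= 3 steps.  Adding up the losses,
    with mu_(a+1) + a + 1 >= mu_s + s for a < s and a_3 > t a_1 for the first
    indices a_1, a_2, a_3 of the three steps, gives |W| <= p + c
    ([staircase_acyclic]).  This is the first fact.

    For the second fact take for W three stars: x_0 with the leaf y_0, y_(m-1)
    with the leaf x_(m-1), and x_(s-1) with the leaf y_(t (s-1) - 1), where each
    other vertex of W is a neighbour of a centre.  These leaves are split off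
    one after the other, each time with an acyclic deletion, and the
    cohomology is that of the empty graph moved up by three
    ([staircase_not_acyclic]).  The inequality mu_s < mu_1 makes the third leaf
    survive the first removal, and |W| = p + 3. *)

(** * The Koszul differential *)

Section KoszulDifferential.
Variable N : nat.
Implicit Types (i j v : 'I_N) (B : {set 'I_N}).

Definition nbefore i B : nat := #|[set j in B | j < i]|.

Lemma nbefore_setD1 i j B :
  nbefore j B = (i \in B) && (i < j) + nbefore j (B :\ i).
Proof.
rewrite /nbefore (cardsD1 i) inE; congr (_ + _).
by apply: eq_card => x; rewrite !inE andbA.
Qed.

Section Module.
Variables (R : comNzRingType) (M : lmodType R) (c : 'I_N -> R).
Local Open Scope ring_scope.
Implicit Types u w : {set 'I_N} -> M.

(** The Koszul complex of the sequence c, with the wedge of the basis elements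
    outside B placed at B: the value at B has homological degree N - #|B|, and
    the differential is exterior multiplication by the sum of the c_i e_i.
    With the variables as c this is the Koszul complex of a polynomial ring;
    with c = 1 it is the simplicial coboundary. *)
Definition koszul u B : M :=
  \sum_(i in B) ((-1) ^+ nbefore i B * c i) *: u (B :\ i).

Lemma eq_koszul u w B :
  (forall i, i \in B -> u (B :\ i) = w (B :\ i)) -> koszul u B = koszul w B.
Proof. by move=> e; apply: eq_bigr => i /e ->. Qed.

Lemma koszulD u w B :
  koszul (fun A => u A + w A) B = koszul u B + koszul w B.
Proof. by rewrite /koszul -big_split; apply: eq_bigr => i _; rewrite scalerDr. Qed.

Lemma koszulN u B : koszul (fun A => - u A) B = - koszul u B.
Proof. by rewrite /koszul -sumrN; apply: eq_bigr => i _; rewrite scalerN. Qed.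

Lemma koszulB u w B :
  koszul (fun A => u A - w A) B = koszul u B - koszul w B.
Proof. by rewrite koszulD koszulN. Qed.

Lemma koszul0 B : koszul (fun=> 0) B = 0.
Proof. by apply: big1 => i _; rewrite scaler0. Qed.

(** Removing i before j, or j before i, gives opposite signs. *)
Lemma koszulK u B : koszul (koszul u) B = 0.
Proof.
pose T i j : M := (((-1) ^+ nbefore i B * c i) *
   ((-1) ^+ nbefore j (B :\ i) * c j)) *: u (B :\ i :\ j).
have -> : koszul (koszul u) B =
    \sum_(p : 'I_N * 'I_N | [&& p.1 \in B, p.2 \in B & p.1 != p.2]) T p.1 p.2.
  transitivity (\sum_(i in B) \sum_(j in B :\ i) T i j).
    apply: eq_bigr => i _; rewrite scaler_sumr.
    by apply: eq_bigr => j _; rewrite scalerA.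
  rewrite pair_big_dep; apply: eq_bigl => p /=.
  by rewrite !inE [p.2 == _]eq_sym [_ && (_ \in B)]andbC.
(* The terms with i < j cancel those with j < i, in any characteristic. *)
rewrite (bigID (fun p : 'I_N * 'I_N => (p.1 < p.2)%N)) /=.
rewrite [X in _ + X](reindex_inj (h := fun p => (p.2, p.1))) /=; last first.
  by move=> [a b] [a' b'] [-> ->].
rewrite [X in _ + X](eq_bigl (fun p : 'I_N * 'I_N =>
  [&& p.1 \in B, p.2 \in B & p.1 != p.2] && (p.1 < p.2)%N)); last first.
  move=> [i j] /=; rewrite [j == i]eq_sym; case: eqVneq => [->|ne]; rewrite ?andbF //.
  rewrite !andbT -leqNgt leq_eqVlt.
  have -> : (nat_of_ord i == j) = false by apply: contra_neqF ne => /eqP/val_inj.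
  by rewrite /= [_ && (j \in B)]andbC.
rewrite -big_split; apply: big1 => -[i j] /= /andP[/and3P[iB jB ne] ij].
rewrite /T setDDl setUC -setDDl -scalerDl.
rewrite (nbefore_setD1 i j B) (nbefore_setD1 j i B) iB jB ij ltnNge ltnW //= add0n.
rewrite add1n exprS; set x := _ ^+ _; set y := _ ^+ _.
rewrite mulN1r !mulNr mulrACA [X in _ - X]mulrACA.
by rewrite [y * x]mulrC [c j * c i]mulrC subrr scale0r.
Qed.

End Module.

Lemma koszul_mulmx (R : comNzRingType) (c : 'I_N -> R) r1 r2
    (D : 'M[R]_(r1, r2)) (u : {set 'I_N} -> 'rV[R]_r1) B :
  koszul c (fun A => u A *m D)%R B = (koszul c u B *m D)%R.
Proof.
by rewrite mulmx_suml; apply: eq_bigr => i _; rewrite scalemxAl.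
Qed.

End KoszulDifferential.

(** * Acyclic families of sets *)

Section AcyclicFamilies.
Variables (k : fieldType) (N : nat).
Local Open Scope ring_scope.
Implicit Types (A B C : {set 'I_N}) (g h : {set 'I_N} -> k^o).
Implicit Types (P : pred {set 'I_N}) (D : pred nat).

Definition cobound g : {set 'I_N} -> k^o := koszul (fun=> 1) g.

Definition cochain P D g : Prop := forall B, ~~ (P B && D #|B|) -> g B = 0.

(** Sizes are restricted by a predicate D, so that one notion covers both all
    sizes at once and a single cohomological degree; a coboundary of size D
    comes from a cochain of size [down D]. *)
Definition down (D : pred nat) : pred nat := fun q => D q.+1.

(** The cochains supported on a convex family P form a subquotient of the
    coboundary complex on all sets; [acyclic] says that its cohomology vanishes
    in the sizes allowed by D.  Simplicial complexes, deletions and links (with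
    the linked vertex kept in each set) are all convex families. *)
Definition acyclic P D : Prop := forall g, cochain P D g ->
  (forall B, P B -> cobound g B = 0) ->
  exists2 h, cochain P (down D) h & forall B, P B -> g B = cobound h B.

Definition convex P : Prop := forall A B C,
  A \subset B -> B \subset C -> P A -> P C -> P B.

Definition restr P g B : k^o := if P B then g B else 0.

Lemma eq_acyclic P P' D : P =1 P' -> acyclic P D -> acyclic P' D.
Proof.
move=> e ac g gP dg; have [||h hP gh] := ac g.
- by move=> B; rewrite e; apply: gP.
- by move=> B; rewrite e; apply: dg.
exists h; first by move=> B; rewrite -e; apply: hP.
by move=> B; rewrite -e; apply: gh.
Qed.

Lemma cochainP P D g B : cochain P D g -> ~~ P B -> g B = 0.
Proof. by move=> gP nB; apply: gP; rewrite negb_and nB. Qed.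

Lemma eq_cobound g h B :
  (forall i, i \in B -> g (B :\ i) = h (B :\ i)) -> cobound g B = cobound h B.
Proof. exact: eq_koszul. Qed.

Lemma cochain_restr (P Q : pred {set 'I_N}) D g :
  cochain P D g -> cochain (fun B => P B && Q B) D (restr Q g).
Proof.
move=> gP B; rewrite /restr; case: (Q B) => //.
by rewrite andbT => /gP.
Qed.

Lemma cochain_cobound D g B :
  (forall A, ~~ down D #|A| -> g A = 0) -> ~~ D #|B| -> cobound g B = 0.
Proof.
move=> gD nB; apply: big1 => i iB; rewrite gD ?scaler0 //.
by rewrite /down; move: nB; rewrite (cardsD1 i) iB.
Qed.

(** The restricted coboundary squares to zero because a convex family contains
    every set lying between two of its members. *)
Lemma cobound_restr P D g B : convex P -> cochain P D g -> P B ->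
  cobound (restr P (cobound g)) B = 0.
Proof.
move=> cP gP PB; rewrite -[RHS](koszulK (fun=> 1) g B).
apply: eq_cobound => i iB; rewrite /restr; case: ifPn => // nP.
rewrite -[LHS](koszul0 k^o (fun=> 1) (B :\ i)); apply: eq_koszul => j jB.
symmetry; apply/eqP; apply: contraNT nP => nz.
apply: (cP (B :\ i :\ j) _ B) => //; rewrite ?subD1set //.
by apply: contra_neqT nz; apply: cochainP gP.
Qed.

(** For a simplicial complex this says that it is a cone with apex v. *)
Definition toggle_invariant P (v : 'I_N) := forall B, v \notin B -> P (v |: B) = P B.

Lemma nbefore_setU1 (i j : 'I_N) B : i \notin B ->
  nbefore j (i |: B) = ((i < j) + nbefore j B)%N.
Proof. by move=> iB; rewrite (nbefore_setD1 i) setU11 setU1K. Qed.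

(** Contraction by v is a homotopy between the identity and zero. *)
Lemma cone_acyclic P D v : toggle_invariant P v -> acyclic P D.
Proof.
move=> tP g gP dg.
pose h B : k^o := if v \in B then 0 else (-1) ^+ nbefore v B *: g (v |: B).
exists h => [B|B PB].
  rewrite /h; case: ifPn => // vB nB; rewrite gP ?scaler0 //.
  by rewrite tP // cardsU1 vB.
rewrite /cobound /koszul; case: (boolP (v \in B)) => vB.
  rewrite (big_setD1 v) //= big1 ?addr0; last first.
    by move=> i; rewrite !inE /h => /andP[ne iB]; rewrite !inE eq_sym ne vB scaler0.
  rewrite /h setD11 setD1K // scalerA mulr1 -exprD (nbefore_setD1 v v) ltnn andbF.
  by rewrite addnn -mul2n exprM sqrrN expr1n expr1n scale1r.
have := dg (v |: B); rewrite tP // => /(_ PB).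
rewrite /cobound /koszul big_setU1 //= setU1K // nbefore_setU1 // ltnn mulr1.
move/eqP; rewrite addr_eq0 => /eqP e.
have -> : g B = (-1) ^+ nbefore v B *: ((-1) ^+ nbefore v B *: g B).
  by rewrite scalerA -exprD addnn -mul2n exprM sqrrN expr1n expr1n scale1r.
rewrite e scalerN scaler_sumr -sumrN; apply: eq_bigr => i iB.
have ne : v != i by apply: contraNneq vB => ->.
rewrite /h !inE (negPf vB) andbF.
rewrite -scalerN -scaleNr !mulr1 !scalerA.
have -> : (v |: B) :\ i = v |: B :\ i.
  by apply/setP => x; rewrite !inE; case: (eqVneq x v) => [->|//]; rewrite ne.
congr (_ *: _); rewrite nbefore_setU1 // (nbefore_setD1 i v) iB /=.
have : i != v :> nat by rewrite eq_sym.
case: ltngtP => // _ _; rewrite !add0n ?add1n ?exprS ?mulN1r ?mulrN ?mulNr ?opprK //.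
  by rewrite mulrC.
by rewrite mulrC.
Qed.

Section Split.
Variables (P : pred {set 'I_N}) (v : 'I_N).
Hypothesis cP : convex P.
Let P0 : pred {set 'I_N} := fun B => P B && (v \notin B).
Let P1 : pred {set 'I_N} := fun B => P B && (v \in B).

(** The members of P that contain v form a subcomplex, since the coboundary only
    adds elements; those that avoid v form the quotient.  This is the exactness
    of the long sequence at the middle term. *)
Lemma split_acyclic D : acyclic P0 D -> acyclic P1 D -> acyclic P D.
Proof.
move=> a0 a1 g gP dg.
have [||h0 h0P e0] := a0 (restr (fun B => v \notin B) g).
- exact: cochain_restr.
- move=> B /andP[PB vB]; rewrite -(dg B PB); apply: eq_cobound => i _.
  by rewrite /restr !inE negb_and vB orbT.
have h0P' : cochain P (down D) h0.
  by move=> B nB; apply: h0P; apply: contra nB => /andP[/andP[-> _] ->].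
(* Once corrected by h0, the cocycle lives on the sets that contain v. *)
pose g1 B := g B - restr P (cobound h0) B.
have g1P : cochain P1 D g1.
  move=> B nB; rewrite /g1 /restr.
  case PB: (P B); last by rewrite subr0; apply: cochainP gP _; rewrite PB.
  case: (boolP (v \in B)) => vB.
    move: nB; rewrite /P1 PB vB /= => nB.
    rewrite gP ?PB // sub0r (@cochain_cobound D) ?oppr0 // => A nA.
    by apply: h0P; rewrite (negPf nA) andbF.
  have := e0 B; rewrite /P0 PB vB => /(_ isT) <-.
  by rewrite /restr vB subrr.
have [B /andP[PB _]|h1 h1P e1] := a1 g1 g1P.
  by rewrite /cobound koszulB [koszul _ _ _]dg // [koszul _ _ _](cobound_restr cP h0P') // subrr.
exists (fun B => h0 B + h1 B) => [B nB|B PB].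
  rewrite h0P' // h1P ?addr0 //.
  by apply: contra nB => /andP[/andP[-> _] ->].
rewrite /cobound koszulD; case: (boolP (v \in B)) => vB.
  have := e1 B; rewrite /P1 PB vB => /(_ isT); rewrite /g1 /restr PB.
  by move/eqP; rewrite subr_eq addrC => /eqP.
have := e0 B; rewrite /P0 PB vB /restr vB => /(_ isT) ->.
rewrite [X in _ + X](_ : _ = 0) ?addr0 //.
rewrite -[RHS](koszul0 k^o (fun=> 1) B); apply: eq_koszul => i iB.
by apply: cochainP h1P _; rewrite /P1 !inE (negPf vB) !andbF.
Qed.

(** Exactness of the same long sequence at the subcomplex: the connecting map
    starts from the quotient one size below. *)
Lemma unsplit_acyclic D : acyclic P0 (down D) -> acyclic P D -> acyclic P1 D.
Proof.
move=> a0 a g gP dg.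
have nv h D' B : cochain P1 D' h -> v \notin B -> cobound h B = 0.
  move=> hP vB; rewrite -[RHS](koszul0 k^o (fun=> 1) B); apply: eq_koszul => i iB.
  by apply: cochainP hP _; rewrite /P1 !inE (negPf vB) !andbF.
have gP' : cochain P D g.
  by move=> B nB; apply: gP; apply: contra nB => /andP[/andP[-> _] ->].
have [B PB|h hP e] := a g gP'.
  case: (boolP (v \in B)) => vB; last exact: nv gP _.
  by apply: dg; rewrite /P1 PB.
have [||l lP el] := a0 (restr (fun B => v \notin B) h).
- exact: cochain_restr.
- move=> B /andP[PB vB]; transitivity (cobound h B).
    by apply: eq_cobound => i _; rewrite /restr !inE negb_and vB orbT.
  by rewrite -e //; apply: cochainP gP _; rewrite /P1 negb_and vB orbT.
have lP' : cochain P (down (down D)) l.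
  by move=> B nB; apply: lP; apply: contra nB => /andP[/andP[-> _] ->].
exists (fun B => h B - restr P (cobound l) B) => [B nB|B /andP[PB vB]].
  rewrite /restr; case PB: (P B); last by rewrite subr0; apply: cochainP hP _; rewrite PB.
  case: (boolP (v \in B)) => vB.
    move: nB; rewrite /P1 PB vB /= => nB.
    rewrite hP ?PB // sub0r (@cochain_cobound (down D)) ?oppr0 // => A nA.
    by apply: lP; rewrite (negPf nA) andbF.
  have := el B; rewrite /P0 PB vB => /(_ isT) <-.
  by rewrite /restr vB subrr.
by rewrite e // {2}/cobound koszulB [X in _ - X](cobound_restr cP lP') // subr0.
Qed.

End Split.
End AcyclicFamilies.

(** * Koszul complexes in each multidegree *)

Lemma seq_all_exists (T : eqType) (U : Type) (u0 : U) (P : T -> U -> Prop)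
    (s : seq T) :
  (forall x, x \in s -> exists y, P x y) ->
  exists f : T -> U, forall x, x \in s -> P x (f x).
Proof.
elim: s => [|x s IH] ex; first by exists (fun=> u0).
have [|f fP] := IH; first by move=> y ys; apply: ex; rewrite inE ys orbT.
have [|y yP] := ex x; first exact: mem_head.
exists (fun z => if z == x then y else f z) => z.
by rewrite inE; case: eqP => [->|_] //= /fP.
Qed.

Section Multidegrees.
Variables (k : fieldType) (N : nat).
Local Notation S := {mpoly k[N]}.
Local Open Scope ring_scope.
Implicit Types (A B : {set 'I_N}) (a m : 'X_{1..N}).

Lemma mcoeff_mulX (f : S) i m :
  ('X_i * f)@_m = if (U_(i) <= m)%MM then f@_(m - U_(i)) else 0.
Proof.
rewrite mulrC; case: ifP => [le|/negP nle].
  by rewrite -{1}(submK le) addmC mcoeffMX.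
apply: memN_msupp_eq0; rewrite (perm_mem (msuppMX _ _)); apply/mapP=> -[m' _ e].
by apply: nle; rewrite e lem_addr.
Qed.

Definition mnm_set A : 'X_{1..N} := [multinom (i \in A : nat) | i < N].

Lemma mnm_set_setCD1 B i : i \in B -> (mnm_set (~: (B :\ i)) = mnm_set (~: B) + U_(i))%MM.
Proof.
move=> iB; apply/mnmP => j; rewrite !mnmE !inE [j == i]eq_sym.
by case: eqVneq => [<-|_]; rewrite ?iB ?addn0.
Qed.

Lemma mnm_set_le A a : (mnm_set A <= a)%MM = (A \subset [set i | (0 < a i)%N]).
Proof.
apply/mnm_lepP/subsetP => [h i iA | h i].
  by have := h i; rewrite mnmE iA inE.
by rewrite mnmE; case: (boolP (i \in A)) => // /h; rewrite inE.
Qed.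

Definition koszulX r : ({set 'I_N} -> 'rV[S]_r) -> {set 'I_N} -> 'rV[S]_r :=
  koszul (fun i => 'X_i).

(** The multidegree of X^m at B is m + 1 outside B, so the component of u in
    multidegree a has a single coefficient for each B. *)
Definition mdcomp r a (c : 'I_r) (u : {set 'I_N} -> 'rV[S]_r) B : k^o :=
  if (mnm_set (~: B) <= a)%MM then (u B 0 c)@_(a - mnm_set (~: B)) else 0.

(** In a fixed multidegree the variables disappear from the Koszul differential. *)
Lemma mdcomp_koszulX r a (c : 'I_r) u B :
  mdcomp a c (koszulX u) B = cobound (mdcomp a c u) B.
Proof.
rewrite /mdcomp /koszulX /koszul summxE raddf_sum /=.
have lei i : i \in B -> (mnm_set (~: (B :\ i)) <= a)%MM =
    (mnm_set (~: B) <= a)%MM && (U_(i) <= a - mnm_set (~: B))%MM.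
  move=> iB; rewrite mnm_set_setCD1 // lep1mP.
  apply/mnm_lepP/andP => [h|[/mnm_lepP h1 h2] j].
    split; first by apply/mnm_lepP => j; apply: leq_trans (h j); rewrite mnmDE leq_addr.
    have := h i; rewrite mnmDE !mnmE eqxx addn1 => h'.
    by rewrite -lt0n subn_gt0.
  move: (h1 j); rewrite !mnmE; case: (eqVneq i j) => [<- _|_]; last by rewrite addn0.
  by move: h2; rewrite !mnmE -lt0n subn_gt0 addn1.
case: ifP => [le|nle]; last first.
  by symmetry; apply: big1 => i iB; rewrite lei // nle scaler0.
apply: eq_bigr => i iB.
have -> : (if (mnm_set (~: (B :\ i)) <= a)%MM
   then (u (B :\ i) 0 c)@_(a - mnm_set (~: (B :\ i))) else 0)
   = ('X_i * u (B :\ i) 0 c)@_(a - mnm_set (~: B)).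
  rewrite lei // le mcoeff_mulX /= mnm_set_setCD1 // submDA.
  by case: ifP.
rewrite mxE -mulrA mulr1 -signr_odd -[in RHS]signr_odd.
by case: odd; rewrite ?expr0 ?expr1 ?mul1r ?scale1r // mulN1r scaleN1r mcoeffN.
Qed.

Lemma mdcompB r a (c : 'I_r) u v B :
  mdcomp a c (fun A => u A - v A) B = mdcomp a c u B - mdcomp a c v B.
Proof. by rewrite /mdcomp; case: ifP => _; rewrite ?subr0 // mxE mxE mcoeffB. Qed.

Lemma mdcompE r (c : 'I_r) u B m : mdcomp (m + mnm_set (~: B)) c u B = (u B 0 c)@_m.
Proof. by rewrite /mdcomp lem_addl addmK. Qed.

Section Bad.
(** A monomial ideal is given by the set [bad] of its monomials. *)
Variable bad : pred 'X_{1..N}.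
Hypothesis bad_up : forall m m', (m <= m')%MM -> bad m -> bad m'.

(** The sets B at which the Koszul complex of the quotient by the monomial ideal
    is nonzero in multidegree a. *)
Definition strand a : pred {set 'I_N} := fun B =>
  (mnm_set (~: B) <= a)%MM && ~~ bad (a - mnm_set (~: B))%MM.

Definition in_bad (f : S) := forall m, m \in msupp f -> bad m.

Lemma strandD1 a B i : i \in B -> strand a B ->
  (mnm_set (~: (B :\ i)) <= a)%MM -> strand a (B :\ i).
Proof.
move=> iB /andP[le nb] le'; rewrite /strand le'; apply: contra nb.
apply: bad_up; apply/mnm_lepP => j; rewrite !mnmE; apply: leq_sub2l.
by rewrite !inE; case: (j \in B); rewrite ?andbF ?andbT //; case: eqP.
Qed.

Lemma cobound_strand a r (u : {set 'I_N} -> 'rV[S]_r) (c' : 'I_r) B : strand a B ->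
  cobound (restr (strand a) (mdcomp a c' u)) B = mdcomp a c' (koszulX u) B.
Proof.
move=> sB; rewrite mdcomp_koszulX; apply: eq_cobound => i iB.
rewrite /restr; case: ifPn => // ns; rewrite /mdcomp; case: ifPn => // le.
by rewrite (strandD1 iB sB le) in ns.
Qed.

(** A Koszul cycle modulo a monomial ideal is a boundary as soon as it is one in
    each of its multidegrees.  The last conclusion records that the
    multidegrees of w occur in u, which makes w homogeneous when u is. *)
Lemma koszul_lift r (u : {set 'I_N} -> 'rV[S]_r) D :
  (forall B, ~~ D #|B| -> u B = 0) ->
  (forall B c, in_bad (koszulX u B 0 c)) ->
  (forall B c m, m \in msupp (u B 0 c) -> acyclic k (strand (m + mnm_set (~: B))) D) ->
  exists w, [/\ forall B c, in_bad ((u B - koszulX w B) 0 c),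
    forall B, ~~ down D #|B| -> w B = 0
    & forall B c m, m \in msupp (w B 0 c) -> exists B' m',
        m' \in msupp (u B' 0 c) /\ (m + mnm_set (~: B) = m' + mnm_set (~: B'))%MM].
Proof.
move=> uD cyc ac.
(* L c lists the multidegrees of component c, and f c a is the chosen primitive
   in multidegree a. *)
pose L c := undup (flatten [seq [seq (m + mnm_set (~: B))%MM | m <- msupp (u B 0 c)]
                          | B : {set 'I_N}]).
have LP c a : reflect (exists B m, m \in msupp (u B 0 c) /\ a = (m + mnm_set (~: B))%MM)
                  (a \in L c).
  rewrite mem_undup; apply: (iffP flattenP) => [[s /mapP[B _ ->] /mapP[m mu ->]]|].
    by exists B, m.
  move=> [B [m [mu ->]]]; exists [seq (m + mnm_set (~: B))%MM | m <- msupp (u B 0 c)].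
    by apply/mapP; exists B; rewrite ?mem_enum.
  exact: map_f.
have /fin_all_exists[f fP] : forall c, exists f : 'X_{1..N} -> {set 'I_N} -> k^o,
    forall a, a \in L c -> cochain (strand a) (down D) (f a) /\
      forall B, strand a B -> mdcomp a c u B = cobound (f a) B.
  move=> c; suff ex a : a \in L c -> exists h, cochain (strand a) (down D) h /\
      forall B, strand a B -> mdcomp a c u B = cobound h B.
    exact: (seq_all_exists (fun=> 0) ex).
  move=> aL.
  have aca : acyclic k (strand a) D.
    by have /LP[B [m [mu ->]]] := aL; apply: ac mu.
  have [||h hP e] := aca (restr (strand a) (mdcomp a c u)).
  - move=> B nB; rewrite /restr; case: ifP => // sB; rewrite /mdcomp uD.
      by rewrite mxE mcoeff0 if_same.
    by move: nB; rewrite sB.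
  - move=> B sB; rewrite cobound_strand //.
    rewrite /mdcomp; case: ifP => // _; apply: memN_msupp_eq0.
    by case/andP: sB => _; apply: contra; apply: cyc.
  exists h; split=> // B sB; rewrite -e // /restr sB //.
pose w B : 'rV[S]_r := \row_c
  \sum_(a <- L c | (mnm_set (~: B) <= a)%MM) f c a B *: 'X_[a - mnm_set (~: B)].
have wE a c B : mdcomp a c w B = if a \in L c then f c a B else 0.
  have [aL|/negP aL] := boolP (a \in L c); last first.
    rewrite /mdcomp; case: ifP => // le; rewrite mxE raddf_sum /= big1_seq //.
    move=> a' /andP[le' a'L]; rewrite mcoeffZ mcoeffX.
    case: eqP => [e|_]; last by rewrite mulr0.
    by case: aL; rewrite -(submK le) -e submK.
  rewrite /mdcomp; case: ifP => [le|nle]; last first.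
    have [fc _] := fP c a aL; rewrite (cochainP fc) // /strand nle //.
  rewrite mxE raddf_sum /= -big_filter (bigD1_seq a) ?filter_uniq ?undup_uniq //=; last first.
    by rewrite mem_filter le.
  rewrite mcoeffZ mcoeffX eqxx mulr1 big1_seq ?addr0 // => a' /andP[ne].
  rewrite mem_filter => /andP[le' a'L]; rewrite mcoeffZ mcoeffX.
  case: eqP => [e|_]; last by rewrite mulr0.
  by rewrite -(submK le) -e submK ?eqxx in ne.
exists w; split.
- move=> B c m; rewrite mcoeff_msupp; apply: contraR => nbad.
  set a := (m + mnm_set (~: B))%MM.
  have sB : strand a B by rewrite /strand lem_addl addmK nbad.
  rewrite -(mdcompE c (fun B => u B - koszulX w B) B m) mdcompB mdcomp_koszulX -/a.
  have [aL|aL] := boolP (a \in L c).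
    have [_ e] := fP c a aL; rewrite subr_eq0 e //; apply/eqP/eq_cobound => i iB.
    by rewrite wE aL.
  rewrite [X in X - _](_ : _ = 0); last first.
    rewrite mdcompE; apply: memN_msupp_eq0; apply: contra aL => mu.
    by apply/LP; exists B, m.
  rewrite sub0r oppr_eq0 -[eqbRHS](koszul0 k^o (fun=> 1) B).
  by apply/eqP; apply: (@eq_cobound _ _ _ (fun=> 0)) => i iB; rewrite wE (negPf aL).
- move=> B nB; apply/rowP => c; rewrite !mxE big1_seq // => a /andP[_ /fP[fc _]].
  by rewrite fc ?scale0r // (negPf nB) andbF.
- move=> B c m; rewrite mcoeff_msupp -(mdcompE c w) wE.
  by case: ifP => [/LP[B' [m' [mu' e]]] _|]; [exists B', m' | rewrite eqxx].
Qed.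

(** When a_i >= 2, the variable X_i divides the monomial at B whether or not
    i belongs to B, so membership in the ideal does not see i. *)
Lemma bad_strand_toggle a i : (1 < a i)%N ->
  (forall m m', (forall j, (0 < m j)%N = (0 < m' j)%N) -> bad m = bad m') ->
  toggle_invariant (strand a) i.
Proof.
move=> ai bs B iB; rewrite /strand !mnm_set_le; congr andb.
  apply/subsetP/subsetP => h j; rewrite !inE; last first.
    by rewrite negb_or => /andP[_ jB]; have := h j; rewrite !inE; apply.
  move=> jB; case: (eqVneq j i) => [->|ne]; first exact: ltnW.
  by have := h j; rewrite !inE (negPf ne); apply.
congr (~~ _); apply: bs => j; rewrite !mnmE !inE.
case: (eqVneq j i) => [->|//]; rewrite iB /= !subn_gt0 ai; exact: ltnW.
Qed.

End Bad.

Lemma strand_pred0_toggle a i : (0 < a i)%N -> toggle_invariant (strand pred0 a) i.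
Proof.
move=> ai B iB; rewrite /strand !andbT !mnm_set_le.
apply/subsetP/subsetP => h j; rewrite !inE; last first.
  by rewrite negb_or => /andP[_ jB]; have := h j; rewrite !inE; apply.
move=> jB; case: (eqVneq j i) => [->//|ne].
by have := h j; rewrite !inE (negPf ne); apply.
Qed.

(** The Koszul complex of the polynomial ring is a resolution of k: every
    multidegree other than 0 is a cone, and multidegree 0 only contains the
    constant term at the full set. *)
Lemma koszul_exact r (u : {set 'I_N} -> 'rV[S]_r) D :
  (forall B, ~~ D #|B| -> u B = 0) ->
  (forall B, koszulX u B = 0) -> (forall c, (u setT 0 c)@_0 = 0) ->
  exists w, [/\ forall B, u B = koszulX w B,
    forall B, ~~ down D #|B| -> w B = 0
    & forall B c m, m \in msupp (w B 0 c) -> exists B' m',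
        m' \in msupp (u B' 0 c) /\ (m + mnm_set (~: B) = m' + mnm_set (~: B'))%MM].
Proof.
move=> uD cyc cst.
have [|B c|B c m mu|w [wb wD wm]] := @koszul_lift pred0 _ r u D uD.
- by [].
- by rewrite cyc mxE => m; rewrite msupp0.
- have [a0|] := eqVneq (m + mnm_set (~: B))%MM 0%MM; last first.
    rewrite -mdeg_eq0 mdegE sum_nat_eq0 => /forallPn[i]; rewrite implyTb -lt0n => ai.
    exact: cone_acyclic (strand_pred0_toggle ai).
  have h j : m j = 0%N /\ j \in B.
    move/mnmP: a0 => /(_ j); rewrite !mnmE inE => /eqP.
    by rewrite addn_eq0 => /andP[/eqP -> ]; case: (j \in B).
  have e1 : m = 0%MM by apply/mnmP => j; rewrite mnmE; case: (h j).
  have e2 : B = setT by apply/setP => j; rewrite inE; case: (h j).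
  by move: mu; rewrite e1 e2 mcoeff_msupp cst eqxx.
exists w; split=> // B; apply/rowP => c; apply/eqP; rewrite -subr_eq0.
have := wb B c; rewrite 2!mxE => h; rewrite -msupp_eq0.
by case E: (msupp _) => [//|m s]; have := h m; rewrite E mem_head => /(_ isT).
Qed.

End Multidegrees.

(** * Betti numbers and Koszul homology *)

Section EdgeIdeal.
Variables (k : fieldType) (N : nat) (e : rel 'I_N).
Hypothesis e_irr : irreflexive e.
Local Notation S := {mpoly k[N]}.
Local Open Scope ring_scope.

Definition covers (m : 'X_{1..N}) : bool :=
  [exists p : 'I_N * 'I_N, [&& e p.1 p.2, 0 < m p.1 & 0 < m p.2]%N].

Lemma covers_up m m' : (m <= m')%MM -> covers m -> covers m'.
Proof.
move/mnm_lepP => le /existsP[p /and3P[ep p1 p2]]; apply/existsP; exists p.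
by rewrite ep !(leq_trans _ (le _)).
Qed.

Lemma edge_monomial_le m i j : e i j ->
  (U_(i) + U_(j) <= m)%MM = (0 < m i)%N && (0 < m j)%N.
Proof.
move=> eij; have ne : i != j by apply: contraTneq eij => ->; rewrite e_irr.
apply/mnm_lepP/andP => [h|[hi hj] l].
  by split; [have := h i | have := h j];
     rewrite mnmDE !mnmE eqxx; apply: leq_trans; rewrite ?leq_addr ?leq_addl.
rewrite mnmDE !mnmE; move: hi hj ne.
by case: (eqVneq i l) => [->|_]; case: (eqVneq j l) => [->|_]; rewrite ?eqxx ?addn0.
Qed.

(** The monomials divisible by an edge span the edge ideal as a vector space. *)
Lemma edge_idealP (f : S) : edge_ideal e f <-> in_bad covers f.
Proof.
split=> [[c ->] m|fb].
  rewrite mcoeff_msupp; apply: contraR => nc.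
  rewrite raddf_sum /= big1 // => -[i j] /= eij.
  rewrite -mpolyXD; apply/eqP; rewrite mcoeff_eq0.
  rewrite (perm_mem (msuppMX _ _)); apply/mapP => -[m' _ em].
  case/negP: nc; apply/existsP; exists (i, j); rewrite /= eij -edge_monomial_le //.
  by rewrite em lem_addr.
rewrite [f]mpolyE big_seq; elim/big_ind: _ => [|f1 f2 [c1 ->] [c2 ->]|m mf].
- by exists (fun _ _ => 0); rewrite big1 // => p _; rewrite mul0r.
- exists (fun i j => c1 i j + c2 i j); rewrite -big_split /=.
  by apply: eq_bigr => p _; rewrite mulrDl.
have /existsP[[i j] /= /and3P[eij mi mj]] := fb m mf.
exists (fun i' j' => if (i', j') == (i, j) then f@_m *: 'X_[m - (U_(i) + U_(j))] else 0).
rewrite (bigD1 (i, j)) //= eqxx big1 ?addr0; last first.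
  by move=> [i' j'] /= /andP[_ /negPf ->]; rewrite mul0r.
by rewrite -mpolyXD -scalerAl -mpolyXD submK // edge_monomial_le // mi mj.
Qed.

End EdgeIdeal.

(** Let M_b be the cokernel of [fdiff F b], so that M_0 is S/I and M_(b+1) is
    the first syzygy module of M_b.  The Koszul homology of M_b in positive
    degree is that of M_(b+1) one degree lower, the isomorphism sending the
    class of v to the class of w when the differential of v is the image of w.
    In degree 0, minimality makes the constant vectors of F_b represent each
    homology class of M_b exactly once. *)
Section BettiKoszul.
Variables (k : fieldType) (N : nat).
Local Notation S := {mpoly k[N]}.
Local Open Scope ring_scope.
Variables (I : S -> Prop) (bad : pred 'X_{1..N}).
Hypothesis bad_up : forall m m', (m <= m')%MM -> bad m -> bad m'.
Hypothesis IP : forall f, I f <-> in_bad bad f.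
Variable F : min_graded_free_resolution I.
Implicit Types (B : {set 'I_N}) (m : 'X_{1..N}).

Lemma in_badD (f g : S) : in_bad bad f -> in_bad bad g -> in_bad bad (f + g).
Proof.
by move=> fb gb m /msuppD_le; rewrite mem_cat => /orP[/fb|/gb].
Qed.

Lemma in_badM (f g : S) : in_bad bad g -> in_bad bad (f * g).
Proof.
move=> gb m /msuppM_le /allpairsP[[m1 m2] /= [_ /gb b2 ->]].
by apply: bad_up b2; apply: lem_addl.
Qed.

Lemma in_bad_koszulX r (u : {set 'I_N} -> 'rV[S]_r) B (c : 'I_r) :
  (forall A, in_bad bad (u A 0 c)) -> in_bad bad (koszulX u B 0 c).
Proof.
move=> ub; rewrite summxE; elim/big_ind: _ => [m|f g|i _].
- by rewrite msupp0.
- exact: in_badD.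
- by rewrite mxE; apply: in_badM.
Qed.

(** v represents a Koszul cycle of M_b. *)
Definition syz_cycle b (v : {set 'I_N} -> 'rV[S]_(frank F b)) : Prop :=
  exists w, forall B, koszulX v B = w B *m fdiff F b.

(** v represents a Koszul boundary of M_b. *)
Definition syz_boundary b (v : {set 'I_N} -> 'rV[S]_(frank F b)) : Prop :=
  exists y w, forall B, v B = koszulX y B + w B *m fdiff F b.

(** v lies in homological degree a of the Koszul complex of F_b, and its internal
    degrees belong to E. *)
Definition degrees_in b a (E : pred nat) (v : {set 'I_N} -> 'rV[S]_(frank F b)) :=
  (forall B, (#|B| + a != N)%N -> v B = 0) /\
  forall B c m, m \in msupp (v B 0 c) -> E (mdeg m + a + fdeg c)%N.

Lemma cst_fdiff b (w : 'rV[S]_(frank F b.+1)) c : ((w *m fdiff F b) 0 c)@_0 = 0.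
Proof.
rewrite mxE raddf_sum big1 // => c' _ /=.
by rewrite rmorphM /= fdiff_minimal mulr0.
Qed.

Lemma cst_koszulX r (u : {set 'I_N} -> 'rV[S]_r) B c : (koszulX u B 0 c)@_0 = 0.
Proof.
rewrite summxE raddf_sum big1 // => i _ /=; rewrite mxE !rmorphM /= mcoeffX.
by case: eqP => [/mnmP/(_ i)|_]; rewrite ?mnmE ?eqxx // mulr0 mul0r.
Qed.

Lemma koszulX_mulmx r1 r2 (M : 'M[S]_(r1, r2)) u B :
  koszulX (fun A => u A *m M) B = koszulX u B *m M.
Proof. exact: koszul_mulmx. Qed.

Lemma koszulXK r (u : {set 'I_N} -> 'rV[S]_r) B : koszulX (koszulX u) B = 0.
Proof. exact: koszulK. Qed.

Lemma eq_koszulX r (u v : {set 'I_N} -> 'rV[S]_r) : u =1 v -> koszulX u =1 koszulX v.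
Proof. by move=> e B; apply: eq_koszul => i _; apply: e. Qed.

Lemma koszulXB r (u v : {set 'I_N} -> 'rV[S]_r) B :
  koszulX (fun A => u A - v A) B = koszulX u B - koszulX v B.
Proof. exact: koszulB. Qed.

Lemma card_setC_eq B a : (#|B| + a = N)%N -> #|~: B| = a.
Proof. by move=> e; have := cardsC B; rewrite card_ord -[RHS]e => /addnI. Qed.

Lemma mdeg_mnm_set (A : {set 'I_N}) : mdeg (mnm_set A) = #|A|.
Proof. by rewrite mdegE -sum1_card [RHS]big_mkcond; apply: eq_bigr => i _; rewrite mnmE; case: ifP. Qed.

Lemma degrees_in_fdiff b a E w : degrees_in a E w ->
  degrees_in a E (fun B => w B *m fdiff F b).
Proof.
move=> [w0 wE]; split=> [B /w0 ->|B c m]; first by rewrite mul0mx.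
rewrite mxE => /msupp_sum_le /flattenP[s /mapP[c']].
rewrite mem_filter => /andP[_ _] -> /msuppM_le /allpairsP[[m1 m2] /= [m1w m2d ->]].
by rewrite mdegD -!addnA [(mdeg m2 + _)%N]addnCA (fdiff_graded m2d) addnA; apply: wE m1w.
Qed.

(** Surjectivity of the dimension shift: the image of w in the Koszul complex of
    F_b is a cycle without constant term, hence a boundary. *)
Lemma syz_cycle_unshift b a E w : syz_cycle w -> degrees_in a E w ->
  exists2 v, degrees_in a.+1 E v & forall B, koszulX v B = w B *m fdiff F b.
Proof.
move=> [y ey] wE; have [u0 uE] := degrees_in_fdiff wE.
have [|B|c|v [ev v0 vm]] := @koszul_exact _ _ _ (fun B => w B *m fdiff F b) (fun q => q + a == N)%N.
- exact: u0.
- by rewrite koszulX_mulmx ey; apply/fdiff_exact; exists (y B).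
- exact: cst_fdiff.
exists v => //; split=> [B nB|B c m mv].
  by apply: v0; rewrite /down addSnnS.
have [B' [m' [mu /(congr1 mdeg)]]] := vm B c m mv.
rewrite !mdegD !mdeg_mnm_set (@card_setC_eq B a.+1) ?(@card_setC_eq B' a).
- by move=> ->; apply: uE mu.
- by apply/eqP; apply: contraTT mu => nB; rewrite u0 // mxE msupp0.
- by apply/eqP; apply: contraTT mv => nB; rewrite v0 ?mxE ?msupp0 // /down addSnnS.
Qed.

(** Injectivity of the dimension shift. *)
Lemma syz_boundary_unshift b v w : (forall B, koszulX v B = w B *m fdiff F b) ->
  (forall c, (v setT 0 c)@_0 = 0) -> syz_boundary w -> syz_boundary v.
Proof.
move=> vw v0 [y [y' ew]].
have [|B|c|x [ex _ _]] := @koszul_exact _ _ _ (fun B => v B - y B *m fdiff F b) predT.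
- by [].
- rewrite koszulXB koszulX_mulmx vw ew mulmxDl addrAC subrr add0r.
  by apply/fdiff_exact; exists (y' B).
- by rewrite mxE mxE mcoeffB v0 cst_fdiff subrr.
by exists x, y => B; rewrite -ex subrK.
Qed.

(** The dimension shift is well defined. *)
Lemma syz_boundary_shift b v w : (forall B, koszulX v B = w B *m fdiff F b) ->
  syz_boundary v -> syz_boundary w.
Proof.
move=> vw [x [y ev]].
have /fin_all_exists[y' ey'] : forall B, exists y', w B - koszulX y B = y' *m fdiff F b.+1.
  move=> B; apply/fdiff_exact; rewrite mulmxBl -vw -koszulX_mulmx -koszulXB.
  rewrite (eq_koszulX (v := koszulX x)) ?koszulXK // => A.
  by rewrite ev addrK.
by exists y, y' => B; rewrite -ey' addrC subrK.
Qed.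

Lemma syz_cycle_to_0 b a E w : syz_cycle w -> degrees_in a E w ->
  exists v : {set 'I_N} -> 'rV[S]_(frank F 0),
    [/\ degrees_in (a + b) E v, syz_cycle v & syz_boundary v -> @syz_boundary b w].
Proof.
elim: b a w => [|b IH] a w wc wE; first by exists w; rewrite addn0.
have [v vE vw] := syz_cycle_unshift wc wE.
have [|u [uE uc ub]] := IH _ v _ vE; first by exists w.
by exists u; rewrite -addSnnS; split=> // /ub; apply: syz_boundary_shift.
Qed.

Lemma koszulX_top r (x : 'rV[S]_r) B : koszulX (fun A => if A == setT then x else 0) B = 0.
Proof.
apply: big1 => i iB; case: eqP => [/setP/(_ i)|_]; last exact: scaler0.
by rewrite !inE eqxx.
Qed.

Lemma neq_setT B : (#|B| + 0 != N)%N -> (B == setT) = false.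
Proof. by rewrite addn0; apply: contraNF => /eqP ->; rewrite cardsT card_ord. Qed.

(** A basis element of F_i is a cycle of degree 0 for M_i and not a boundary, as
    boundaries have no constant term; the dimension shifts carry it to a class
    of degree i for S/I. *)
Lemma exists_generator_cycle i (a : 'I_(frank F i)) :
  exists v : {set 'I_N} -> 'rV[S]_(frank F 0),
    [/\ degrees_in i (pred1 (fdeg a)) v, syz_cycle v & ~ syz_boundary v].
Proof.
pose w B : 'rV[S]_(frank F i) := if B == setT then delta_mx 0 a else 0.
have [||v [vE vc vb]] := @syz_cycle_to_0 i 0 (pred1 (fdeg a)) w.
- by exists (fun=> 0) => B; rewrite koszulX_top mul0mx.
- split=> [B nB|B c m]; first by rewrite /w neq_setT.
  rewrite /w; case: ifP => _; rewrite mxE ?msupp0 //=.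
  by case: eqP => [->|_]; rewrite ?msupp0 // msupp1 inE => /eqP ->; rewrite mdeg0 /= eqxx.
exists v; rewrite add0n in vE; split=> // /vb [x [y ew]].
have /eqP := congr1 (fun M : 'rV[S]_(frank F i) => (M 0 a)@_0) (ew setT).
rewrite /w eqxx mxE !eqxx /= mxE mcoeffD cst_koszulX cst_fdiff addr0 mcoeff1 eqxx.
by rewrite oner_eq0.
Qed.

Lemma row1D (x y : 'rV[S]_1) : (x + y) 0 0 = x 0 0 + y 0 0.
Proof. by rewrite mxE. Qed.

Lemma syz_lift (u : {set 'I_N} -> 'rV[S]_1) :
  exists v : {set 'I_N} -> 'rV[S]_(frank F 0),
    forall B, in_bad bad ((u B - v B *m faug F) 0 0).
Proof.
suff ex B : exists v, in_bad bad ((u B - v *m faug F) 0 0) by exact: fin_all_exists ex.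
have [v vI] := faug_surjective F (u B 0 0).
by exists v; rewrite mxE [X in _ + X]mxE; apply/IP.
Qed.

(** A generator of degree j would give a Koszul class of S/I in that degree, which
    vanishes multidegree by multidegree. *)
Lemma betti_eq0 i j :
  (forall a, mdeg a = j -> acyclic k (strand bad a) (fun q => q + i == N)%N) ->
  graded_betti F i j = 0%N.
Proof.
move=> ac; apply/eqP; rewrite cards_eq0; apply/eqP/setP => a; rewrite !inE.
apply/negbTE/eqP => aj; have [v [[v0 vE] [y vc] vb]] := exists_generator_cycle a.
pose u B := v B *m faug F; case: vb.
have [||B c m mu|w [wb _ _]] := @koszul_lift k N bad bad_up 1 u (fun q => q + i == N)%N.
- by move=> B /v0 vB; rewrite /u vB mul0mx.
- move=> B c; rewrite ord1 koszulX_mulmx vc; apply/IP/faug_exact; by exists (y B).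
- apply: ac; have Bi : (#|B| + i = N)%N.
    by apply/eqP; apply: contraTT mu => nB; rewrite /u v0 // mul0mx mxE msupp0.
  rewrite mdegD mdeg_mnm_set (card_setC_eq Bi).
  move: mu; rewrite ord1 mxE => /msupp_sum_le /flattenP[s /mapP[c']].
  rewrite mem_filter => /andP[_ _] -> /msuppM_le /allpairsP[[m1 m2] /= [/vE /eqP m1w m2d ->]].
  by rewrite mdegD (faug_graded m2d) addnAC m1w.
have [x xw] := syz_lift w.
have /fin_all_exists[z ez] : forall B, exists z, v B - koszulX x B = z *m fdiff F 0.
  move=> B; apply/faug_exact/IP; rewrite mulmxBl -koszulX_mulmx.
  rewrite [X in in_bad _ X](_ : _ = (u B - koszulX w B) 0 0 + koszulX (fun A => w A - x A *m faug F) B 0 0).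
    by apply: in_badD; [apply: wb | apply: in_bad_koszulX].
  by rewrite -row1D koszulXB addrA subrK.
by exists x, z => B; rewrite -ez addrC subrK.
Qed.

(** Descending from M_0 to M_i, where classes are constant vectors, and coming
    back shows that every class is a sum of classes in the degrees of the
    generators of F_i.  If no generator has degree j, then degree j can be
    avoided. *)
Lemma syz_cycle_avoid_degree i j : graded_betti F i j = 0%N ->
  forall a b, (a + b)%N = i -> forall v, @syz_cycle b v -> degrees_in a predT v ->
  exists v', [/\ degrees_in a (predC1 j) v', syz_cycle v'
    & syz_boundary (fun B => v B - v' B)].
Proof.
move=> bij; elim=> [|a IH] b.
  rewrite add0n => eb; subst b => v _ [v0 _].
  pose x : 'rV[S]_(frank F i) := \row_c ((v setT 0 c)@_0)%:MP.
  exists (fun B => if B == setT then x else 0); split.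
  - split=> [B nB|B c m]; first by rewrite neq_setT.
    case: ifP => _; rewrite mxE ?msupp0 // msuppC; case: ifP => // _.
    rewrite inE => /eqP ->; rewrite mdeg0 /=; apply/eqP => cj.
    have := card0_eq bij c; rewrite !inE; move: cj; rewrite !add0n => ->; by rewrite eqxx.
  - by exists (fun=> 0) => B; rewrite koszulX_top mul0mx.
  have [|B|c|y [ey _ _]] := @koszul_exact _ _ _ (fun B => v B - if B == setT then x else 0) predT.
  - by [].
  - rewrite koszulXB koszulX_top subr0; apply: big1 => l lB; rewrite v0 ?scaler0 // addn0.
    rewrite neq_ltn; apply/orP; left; rewrite -[ltnRHS]card_ord -cardsT.
    apply: proper_card; apply/properP; split; first exact: subsetT.
    by exists l; rewrite !inE ?eqxx.
  - by rewrite eqxx 3!mxE mcoeffB mcoeffC eqxx mulr1 subrr.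
  by exists y, (fun=> 0) => B; rewrite mul0mx addr0.
move=> abi v [w0 vw0] [v0 _].
(* w0 may have spurious values in other homological degrees. *)
pose w B := if (#|B| + a == N)%N then w0 B else 0.
have vw B : koszulX v B = w B *m fdiff F b.
  rewrite /w; case: ifPn => // nB; rewrite mul0mx; apply: big1 => l lB.
  by rewrite v0 ?scaler0 // -addSnnS; move: nB; rewrite (cardsD1 l) lB.
have /fin_all_exists[y yw] : forall B, exists y, koszulX w B = y *m fdiff F b.+1.
  by move=> B; apply/fdiff_exact; rewrite -koszulX_mulmx -(eq_koszulX vw) koszulXK.
have [|||w' [wE wc wb]] := IH b.+1 _ w.
- by rewrite -addSnnS.
- by exists y.
- by split=> // B nB; rewrite /w (negPf nB).
have [v' vE' vw'] := syz_cycle_unshift wc wE.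
exists v'; split=> //; first by exists w'.
apply: syz_boundary_unshift wb => [B|c]; first by rewrite koszulXB vw vw' mulmxBl.
have nT : (#|[set: 'I_N]| + a.+1 != N)%N.
  by rewrite cardsT card_ord -[X in _ != X]addn0 eqn_add2l.
by rewrite v0 // vE'.1 // subrr mxE mcoeff0.
Qed.

(** Conversely, a cocycle g in multidegree a gives a Koszul cycle of S/I, which is
    homologous to one without component in degree j = mdeg a; comparing the
    components in multidegree a, g is a coboundary. *)
Lemma betti_eq0_acyclic i j : graded_betti F i j = 0%N ->
  forall a, mdeg a = j -> acyclic k (strand bad a) (fun q => q + i == N)%N.
Proof.
move=> bij a aj g gP dg.
pose u B : 'rV[S]_1 := const_mx (g B *: 'X_[a - mnm_set (~: B)]).
have uE a' B : mdcomp a' 0 u B = if a' == a then g B else 0.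
  rewrite /mdcomp; case: ifP => [le|nle].
    rewrite mxE mcoeffZ mcoeffX; case: eqP => [e|ne].
      case: (eqVneq a' a) => [_|ne]; first by rewrite mulr1.
      rewrite (cochainP gP) ?mul0r //; apply: contra ne => /andP[le' _].
      by rewrite -(submK le) -e submK.
    by case: eqP ne => [->//|]; rewrite mulr0.
  by case: eqP nle => // -> nle; rewrite (cochainP gP) // /strand nle.
have u0 B : (#|B| + i != N)%N -> u B = 0.
  by move=> nB; apply/rowP => c; rewrite !mxE gP ?scale0r // negb_and nB orbT.
have ucyc B : in_bad bad (koszulX u B 0 0).
  move=> m; rewrite mcoeff_msupp -(mdcompE 0 (koszulX u)) mdcomp_koszulX; apply: contraR => nb.
  set a' := (m + _)%MM; case: (eqVneq a' a) => ea; last first.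
    rewrite -[eqbRHS](koszul0 k^o (fun=> 1) B); apply/eqP.
    by apply: (@eq_cobound _ _ _ (fun=> 0)) => l _; rewrite uE (negPf ea).
  rewrite -[eqbRHS](dg B); last by rewrite /strand -ea lem_addl addmK.
  by apply/eqP/eq_cobound => l _; rewrite uE ea eqxx.
have [v1 v1u] := syz_lift u.
pose v B := if (#|B| + i == N)%N then v1 B else 0.
have vu B : in_bad bad ((u B - v B *m faug F) 0 0).
  by rewrite /v; case: ifPn => // nB; rewrite u0 // mul0mx subrr mxE => m; rewrite msupp0.
have /fin_all_exists[w vw] : forall B, exists w, koszulX v B = w *m fdiff F 0.
  move=> B; apply/faug_exact/IP; rewrite -koszulX_mulmx.
  rewrite [X in in_bad _ X](_ : _ = koszulX u B 0 0 + -1 * koszulX (fun A => u A - v A *m faug F) B 0 0).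
    by apply: in_badD => //; apply/in_badM/in_bad_koszulX.
  by rewrite koszulXB mulN1r 2!mxE opprB addrC subrK.
have [||v' [[v0' vE'] _ [y [z ez]]]] := @syz_cycle_avoid_degree i j bij i 0 (addn0 i) v.
- by exists w.
- by split=> // B nB; rewrite /v (negPf nB).
pose t B := y B *m faug F; pose u' B := v' B *m faug F.
have ut B : in_bad bad ((u B - u' B - koszulX t B) 0 0).
  rewrite [X in in_bad _ X](_ : _ = (u B - v B *m faug F) 0 0 + ((z B *m fdiff F 0) *m faug F) 0 0).
    by apply: in_badD => //; apply/IP/faug_exact; exists (z B).
  have -> : z B *m fdiff F 0 = v B - v' B - koszulX y B by rewrite ez addrC addKr.
  rewrite !mulmxBl koszulX_mulmx -/(u' B); set p := v B *m _; set q := koszulX y B *m _.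
  by rewrite -row1D 2!addrA subrK.
pose h B := if strand bad a B && (#|B|.+1 + i == N)%N then mdcomp a 0 t B else 0.
exists h => [B nB|B sB]; first by rewrite /h; move: nB; rewrite /down => /negPf ->.
case: (boolP (#|B| + i == N)%N) => Bi; last first.
  rewrite gP ?negb_and ?Bi ?orbT // (@cochain_cobound _ _ (fun q => q + i == N)%N) // => A.
  by rewrite /h /down => /negPf ->; rewrite andbF.
have -> : cobound h B = mdcomp a 0 (koszulX t) B.
  rewrite -(cobound_strand bad_up) //; apply: eq_cobound => l lB.
  have -> : h (B :\ l) = restr (strand bad a) (mdcomp a 0 t) (B :\ l).
    by rewrite /h /restr; move: Bi; rewrite (cardsD1 l) lB add1n => ->; rewrite andbT.
  by [].
have : mdcomp a 0 (fun B => u B - u' B - koszulX t B) B = 0.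
  rewrite /mdcomp; case: ifP => // _; apply: memN_msupp_eq0.
  by case/andP: sB => _; apply: contra; apply: ut.
have -> : mdcomp a 0 (fun B => u B - u' B - koszulX t B) B
   = mdcomp a 0 u B - mdcomp a 0 u' B - mdcomp a 0 (koszulX t) B by rewrite !mdcompB.
rewrite uE eqxx [X in _ - X - _](_ : _ = 0) ?subr0; last first.
  rewrite /mdcomp; case: ifP => // le; apply: memN_msupp_eq0; apply/negP.
  rewrite mxE => /msupp_sum_le /flattenP[s /mapP[c']].
  rewrite mem_filter => /andP[_ _] -> /msuppM_le /allpairsP[[m1 m2] /= [/vE' ne m2d em]].
  have e2 := @faug_graded k N I F c' m2 m2d.
  move: ne; rewrite /= -aj -(submK le) em !mdegD mdeg_mnm_set.
  by rewrite e2 (card_setC_eq (eqP Bi)) addnAC eqxx.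
by move/eqP; rewrite subr_eq0 => /eqP.
Qed.

End BettiKoszul.

(** * Independent sets of a graph *)

Section IndependenceFamilies.
Variables (k : fieldType) (N : nat) (e : rel 'I_N).
Hypotheses (e_sym : ssrbool.symmetric e) (e_irr : irreflexive e).
Implicit Types (A B C W Z R : {set 'I_N}) (D : pred nat).

Definition independent B : bool := [forall i in B, forall j in B, ~~ e i j].

Lemma independentP B :
  reflect {in B &, forall i j, ~~ e i j} (independent B).
Proof.
apply: (iffP forall_inP) => [h i j iB jB|h i iB].
  by have /forall_inP := h i iB; apply.
by apply/forall_inP => j; apply: h.
Qed.

Lemma independentS A B : A \subset B -> independent B -> independent A.
Proof.
by move=> /subsetP AB /independentP h; apply/independentP => i j /AB iB /AB; apply: h.
Qed.

(** The independent subsets of W, each enlarged by the fixed set Z.  Links are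
    again of this form, with the linked vertex moved to Z; in a squarefree
    multidegree Z starts as the complement of W. *)
Definition indep_fam W Z : pred {set 'I_N} := fun B =>
  [&& Z \subset B, B \subset Z :|: W & independent (B :&: W)].

Lemma convex_indep_fam W Z : convex (indep_fam W Z).
Proof.
move=> A B C AB BC /and3P[ZA _ _] /and3P[_ CU iC]; apply/and3P; split.
- exact: subset_trans AB.
- exact: subset_trans CU.
- by apply: independentS iC; apply: setSI.
Qed.

Lemma isolated_acyclic W Z D u : u \in W -> u \notin Z ->
  {in W, forall w, ~~ e u w} -> acyclic k (indep_fam W Z) D.
Proof.
move=> uW uZ iso; apply: (@cone_acyclic _ _ _ _ u) => B uB; rewrite /indep_fam.
congr [&& _, _ & _].
- apply/subsetP/subsetP => h i iZ; last by rewrite inE h // orbT.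
  by have := h i iZ; rewrite !inE; case: eqP iZ => // ->; rewrite (negPf uZ).
- by rewrite subUset sub1set inE uW orbT.
apply/independentP/independentP => h i j; rewrite !inE.
  by move=> /andP[iB iW] /andP[jB jW]; apply: h; rewrite !inE ?iB ?jB ?orbT.
move=> /andP[/orP[/eqP->|iB] iW] /andP[/orP[/eqP->|jB] jW]; rewrite ?iso //.
  by rewrite e_sym iso.
by apply: h; rewrite inE ?iB ?jB.
Qed.

Definition del_nbhd W v : {set 'I_N} := [set w in W | (w != v) && ~~ e v w].

Lemma indep_fam_setD1 W Z v : v \notin Z ->
  (fun B => indep_fam W Z B && (v \notin B)) =1 indep_fam (W :\ v) Z.
Proof.
move=> vZ B; rewrite /indep_fam; case vB: (v \in B); rewrite ?andbT ?andbF.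
  symmetry; apply/negP => /and3P[_ /subsetP/(_ v vB)].
  by rewrite !inE eqxx (negPf vZ).
congr [&& _, _ & independent _].
  apply/subsetP/subsetP => h i iB; have := h i iB; rewrite !inE.
    by case: eqP iB => [->|//]; rewrite vB.
  by case/orP => [->|/andP[_ ->]]; rewrite ?orbT.
by apply/setP => i; rewrite !inE; case: eqP => [->|//]; rewrite vB.
Qed.

Lemma indep_fam_del_nbhd W Z v : v \in W -> [disjoint Z & W] ->
  (fun B => indep_fam W Z B && (v \in B)) =1 indep_fam (del_nbhd W v) (v |: Z).
Proof.
move=> vW dZW B; rewrite /indep_fam subUset sub1set; case vB: (v \in B); rewrite ?andbF //= andbT.
congr andb; apply/andP/andP => -[/subsetP BU /independentP iB]; split.
- apply/subsetP => i iB'; have := BU i iB'; rewrite !inE => /orP[->|iW]; rewrite ?orbT //.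
  rewrite iW; case: eqP => //= _; rewrite iB ?orbT // !inE ?vB ?iB' //.
- apply/independentP => i j; rewrite !inE => /and3P[i1 i2 _] /and3P[j1 j2 _].
  by apply: iB; rewrite inE ?i1 ?j1.
- apply/subsetP => i iB'; have := BU i iB'; rewrite !inE.
  by case/orP => [/orP[/eqP->|->]|/andP[-> _]]; rewrite ?vW ?orbT.
have cases i : i \in B :&: W -> i = v \/ i \in B :&: del_nbhd W v.
  rewrite !inE => /andP[iB' iW]; have := BU i iB'; rewrite !inE iB' iW.
  case/orP => [/orP[/eqP|iZ]|]; [by left | | by right].
  by rewrite (disjointFr dZW iZ) in iW.
apply/independentP => i j /cases[->|i1] /cases[->|j1].
- by rewrite e_irr.
- by move: j1; rewrite !inE => /and4P[].
- by rewrite e_sym; move: i1; rewrite !inE => /and4P[].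
- exact: iB.
Qed.

Lemma disjoint_del_nbhd W Z v : [disjoint Z & W] ->
  [disjoint v |: Z & del_nbhd W v].
Proof.
move=> dZW; rewrite disjoint_subset; apply/subsetP => i; rewrite !inE.
by case: eqP => [_ _|_ iZ]; rewrite ?andbF //= (disjointFr dZW iZ).
Qed.

Lemma disjoint_notin Z W v : [disjoint Z & W] -> v \in W -> v \notin Z.
Proof. by move=> d vW; rewrite (disjointFl d vW). Qed.

(** The long exact sequence of deletion and link at v. *)
Lemma delete_acyclic W Z D v : v \in W -> [disjoint Z & W] ->
  acyclic k (indep_fam (W :\ v) Z) D -> acyclic k (indep_fam (del_nbhd W v) (v |: Z)) D ->
  acyclic k (indep_fam W Z) D.
Proof.
move=> vW dZW a0 a1; apply: (@split_acyclic _ _ _ v (@convex_indep_fam W Z)).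
  by apply: eq_acyclic a0 => B; rewrite -indep_fam_setD1 // (disjoint_notin dZW).
by apply: eq_acyclic a1 => B; rewrite -indep_fam_del_nbhd.
Qed.

(** If v dominates u, then u is isolated in the link of v, which is therefore a
    cone. *)
Lemma fold_acyclic W Z D u v : v \in W -> u \in W -> u != v -> ~~ e v u ->
  {in W, forall w, e u w -> e v w} -> [disjoint Z & W] ->
  acyclic k (indep_fam (W :\ v) Z) D -> acyclic k (indep_fam W Z) D.
Proof.
move=> vW uW uv nvu dom dZW a0; apply: (@delete_acyclic W Z D v) => //.
apply: (@isolated_acyclic _ _ _ u); first by rewrite !inE uW uv.
  by rewrite !inE (negPf uv) (disjoint_notin dZW).
by move=> w; rewrite !inE => /and3P[wW _]; apply: contra; apply: dom.
Qed.

Lemma fold_set_acyclic W Z D u R : R \subset W -> u \in W -> u \notin R ->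
  {in R, forall v, ~~ e v u} -> {in R & W, forall v w, e u w -> e v w} ->
  [disjoint Z & W] ->
  acyclic k (indep_fam (W :\: R) Z) D -> acyclic k (indep_fam W Z) D.
Proof.
move: {2}#|R| (erefl #|R|) => n; elim: n W R => [|n IH] W R.
  by move=> /eqP; rewrite cards_eq0 => /eqP ->; rewrite setD0.
move=> cR RW uW uR nadj dom dZW a0.
have /card_gt0P[v vR] : 0 < #|R| by rewrite cR.
have uv : u != v by apply: contraNneq uR => ->.
apply: (@fold_acyclic W Z D u v) => //.
- exact: (subsetP RW).
- exact: nadj.
- by move=> w wW; apply: dom.
apply: (IH (W :\ v) (R :\ v)).
- by move: cR; rewrite (cardsD1 v) vR => -[].
- exact: setSD.
- by rewrite !inE uv.
- by rewrite !inE (negPf uR) andbF.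
- by move=> w; rewrite !inE => /andP[_]; apply: nadj.
- by move=> w x; rewrite !inE => /andP[_ wR] /andP[_ xW]; apply: dom.
- by apply: disjointWr dZW; apply: subD1set.
by rewrite setDDl setD1K.
Qed.

(** If x is the only neighbour of y, then deleting x isolates y; only the link of
    x matters. *)
Lemma leaf_acyclic W Z D x y : x \in W -> y \in W -> y != x ->
  {in W, forall w, e y w -> w = x} -> [disjoint Z & W] ->
  acyclic k (indep_fam (del_nbhd W x) (x |: Z)) D -> acyclic k (indep_fam W Z) D.
Proof.
move=> xW yW yx leaf dZW; apply: delete_acyclic => //.
apply: (@isolated_acyclic _ _ _ y); first by rewrite !inE yx.
  exact: disjoint_notin yW.
move=> w; rewrite !inE => /andP[wx wW]; apply: contra wx => eyw.
by apply/eqP/leaf.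
Qed.

(** The deletion of x is acyclic in all sizes, so the cohomology of the link of x
    embeds into that of W. *)
Lemma leaf_unlink W Z D x y : x \in W -> y \in W -> y != x ->
  {in W, forall w, e y w -> w = x} -> [disjoint Z & W] ->
  acyclic k (indep_fam W Z) D -> acyclic k (indep_fam (del_nbhd W x) (x |: Z)) D.
Proof.
move=> xW yW yx leaf dZW aW.
apply: (eq_acyclic (indep_fam_del_nbhd xW dZW)).
apply: unsplit_acyclic aW; first exact: convex_indep_fam.
have a0 : acyclic k (indep_fam (W :\ x) Z) (down D).
  apply: (@isolated_acyclic _ _ _ y); first by rewrite !inE yx.
    exact: disjoint_notin yW.
  move=> w; rewrite !inE => /andP[wx wW]; apply: contra wx => eyw.
  by apply/eqP/leaf.
by apply: eq_acyclic a0 => B; rewrite -indep_fam_setD1 // (disjoint_notin dZW).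
Qed.

Lemma indep_fam_set0 Z B : indep_fam set0 Z B = (B == Z).
Proof.
rewrite /indep_fam setU0 setI0; have -> : independent set0 by apply/independentP => i j; rewrite inE.
by rewrite andbT eqEsubset andbC.
Qed.

Lemma indep_fam_set0_acyclic Z D : ~~ D #|Z| -> acyclic k (indep_fam set0 Z) D.
Proof.
move=> nD g gP _; exists (fun=> 0)%R => // B; rewrite indep_fam_set0 => /eqP ->.
by rewrite gP ?indep_fam_set0 ?eqxx // /cobound koszul0.
Qed.

Lemma indep_fam_set0_not_acyclic Z D : D #|Z| -> ~~ D #|Z|.+1 ->
  ~ acyclic k (indep_fam set0 Z) D.
Proof.
move=> DZ nD /(_ (fun B => if B == Z then 1 else 0)%R) [|B|h hP].
- by move=> B; rewrite indep_fam_set0; case: eqP => // ->; rewrite DZ.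
- rewrite indep_fam_set0 => /eqP ->; apply: big1 => i iZ.
  case: eqP => [/setP/(_ i)|_]; last exact: scaler0.
  by rewrite !inE iZ eqxx.
move=> /(_ Z); rewrite indep_fam_set0 eqxx => /(_ isT).
rewrite [X in _ = X](_ : _ = 0)%R; first by move/eqP; rewrite oner_eq0.
apply: big1 => i iZ; rewrite hP ?scaler0 // indep_fam_set0.
rewrite negb_and /down; apply/orP; left.
by apply: contraTneq iZ => /setP/(_ i); rewrite !inE eqxx /= => <-.
Qed.

(** In a squarefree multidegree with support W, the monomial at B is the product of
    the variables in the intersection of B and W. *)
Lemma strand_indep_fam (a : 'X_{1..N}) : (forall i, a i <= 1) ->
  strand (covers e) a =1 indep_fam [set i | 0 < a i] (~: [set i | 0 < a i]).
Proof.
set W := [set i | _] => sq B; rewrite /strand mnm_set_le -/W -setCS setCK /indep_fam.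
rewrite setUC setUCr subsetT /=; congr andb.
have sup i : (0 < (a - mnm_set (~: B))%MM i) = (i \in B :&: W).
  rewrite !mnmE !inE subn_gt0; case: (i \in B) => //=.
  by have := sq i; case: (a i) => [|[|]].
apply/negP/independentP => [nc i j iB jB|ind /existsP[[i j] /= /and3P[eij]]].
  by apply/negP => eij; apply: nc; apply/existsP; exists (i, j); rewrite /= eij !sup iB jB.
by rewrite !sup => iB jB; have := ind i j iB jB; rewrite eij.
Qed.

(** Half of the formula of Hochster: only squarefree multidegrees, that is induced
    subgraphs, can carry cohomology. *)
Lemma strand_acyclic D (a : 'X_{1..N}) :
  (forall W, #|W| = mdeg a -> acyclic k (indep_fam W (~: W)) D) ->
  acyclic k (strand (covers e) a) D.
Proof.
move=> ac; case: (boolP [forall i, a i <= 1]) => [/forallP sq|].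
  apply: eq_acyclic (ac _ _) => [B|]; first by rewrite strand_indep_fam.
  rewrite mdegE -sum1_card big_mkcond /=; apply: eq_bigr => i _; rewrite inE.
  by have := sq i; case: (a i) => [|[|]].
move=> /forallPn[i]; rewrite -ltnNge => ai; apply: cone_acyclic.
apply: bad_strand_toggle ai _ => m m' mm'; rewrite /covers.
by apply: eq_existsb => p; rewrite !mm'.
Qed.

End IndependenceFamilies.

(** * Staircase graphs *)

Lemma card_ord_range (m lo hi : nat) : hi <= m ->
  #|[set i : 'I_m | lo <= i < hi]| = hi - lo.
Proof.
move=> him; rewrite -sum1_card -[RHS]muln1 -sum_nat_const_nat.
rewrite big_geq_mkord (big_ord_widen_cond _ (fun i => lo <= i) (fun=> 1) him).
by apply: eq_bigl => i; rewrite inE.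
Qed.

Section Staircase.
Variables (k : fieldType) (m : nat) (t : 'I_m -> nat) (e : rel 'I_(m + m)).
Hypotheses (e_sym : ssrbool.symmetric e) (e_irr : irreflexive e).
Hypothesis exy : forall a b, e (vx a) (vy b) = (a <= b < t a).
Hypothesis exx : forall a b, e (vx a) (vx b) = false.
Hypothesis eyy : forall a b, e (vy a) (vy b) = false.
Hypothesis t_mono : forall a b : 'I_m, a <= b -> t a <= t b.
Hypothesis t_le : forall a, t a <= m.
Implicit Types (W Z : {set 'I_(m + m)}) (D : pred nat).

Lemma vxP (v : 'I_(m + m)) : (exists a, v = vx a) \/ (exists b, v = vy b).
Proof.
by rewrite -(splitK v); case: (split v) => a; [left | right]; exists a.
Qed.

Lemma vx_inj : injective (@vx m). Proof. exact: lshift_inj. Qed.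
Lemma vy_inj : injective (@vy m). Proof. exact: rshift_inj. Qed.

Lemma vxy a b : (vx a == vy b :> 'I_(m + m)) = false.
Proof. exact: eq_lrshift. Qed.

Lemma eyx a b : e (vy b) (vx a) = (a <= b < t a).
Proof. by rewrite e_sym exy. Qed.

Lemma card_xy W :
  #|W| = #|[set a | vx a \in W]| + #|[set b | vy b \in W]|.
Proof.
rewrite -!sum1_card big_mkcond [X in _ = X + _]big_mkcond [X in _ = _ + X]big_mkcond.
rewrite big_split_ord /=.
by congr (_ + _); apply: eq_bigr => i _; rewrite inE.
Qed.

(** One round of the greedy reduction: a is the first x-index of W and j the first
    y-index. *)
Lemma staircase_step W Z D : W != set0 -> [disjoint Z & W] ->
  (forall (a j : 'I_m) W', vx a \in W -> vy j \in W -> a <= j < t a ->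
     (forall i, vx i \in W' -> (vx i \in W) && (j < i)) ->
     (forall b, vy b \in W' -> (vy b \in W) && (t a <= b)) ->
     #|W| <= #|W'| + (t a - a).+1 -> [disjoint vx a |: Z & W'] ->
     acyclic k (indep_fam e W' (vx a |: Z)) D) ->
  acyclic k (indep_fam e W Z) D.
Proof.
move=> W0 dZW next.
case: (boolP [exists u in W, [forall w in W, ~~ e u w]]) => [/exists_inP[u uW]|].
  move=> /forall_inP iso; apply: (isolated_acyclic e_sym uW) => //.
  exact: disjoint_notin uW.
move=> /exists_inPn niso.
have nb u : u \in W -> exists2 w, w \in W & e u w.
  by move=> /niso /forall_inPn[w wW]; rewrite negbK; exists w.
have [[a0 a0W] [j0 j0W]] : (exists a, vx a \in W) /\ (exists b, vy b \in W).
  have /set0Pn[u uW] := W0; have [w wW] := nb u uW.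
  case: (vxP u) uW => -[a ->] aW; case: (vxP w) wW => -[b ->] bW; rewrite ?exx ?eyy // => _.
    by split; [exists a | exists b].
  by split; [exists b | exists a].
pose a : 'I_m := [arg min_(i < a0 | vx i \in W) i].
pose j : 'I_m := [arg min_(i < j0 | vy i \in W) i].
have [aW amin] : vx a \in W /\ forall i, vx i \in W -> a <= i.
  by rewrite /a; case: arg_minnP.
have [jW jmin] : vy j \in W /\ forall i, vy i \in W -> j <= i.
  by rewrite /j; case: arg_minnP.
have aj : a <= j < t a.
  have [w wW] := nb _ jW; case: (vxP w) wW => -[i ->] iW; rewrite ?eyy // eyx => /andP[ij _].
  rewrite (leq_trans (amin _ iW) ij) /=.
  have [w' wW'] := nb _ aW; case: (vxP w') wW' => -[b ->] bW; rewrite ?exx // exy => /andP[_].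
  exact: leq_ltn_trans (jmin _ bW).
(* The x_i with a < i <= j see every neighbour of x_a in W, because t grows. *)
pose R := [set v in W | [exists i : 'I_m, [&& v == vx i, i <= j & i != a]]].
have inRx i : (vx i \in R) = [&& vx i \in W, i <= j & i != a].
  rewrite inE; congr andb; apply/existsP/idP => [[i' /and3P[/eqP/vx_inj<- -> ->]]//|h].
  by exists i; rewrite eqxx.
have inRy b : vy b \in R = false.
  by rewrite inE; apply/negP => /andP[_ /existsP[i]]; rewrite eq_sym vxy.
have RW : R \subset W by apply/subsetP => v; rewrite inE => /andP[].
apply: (@fold_set_acyclic k _ e e_sym e_irr W Z D (vx a) R) => //.
- by rewrite inRx eqxx !andbF.
- by move=> v; case: (vxP v) => -[i ->]; rewrite ?inRy // exx.
- move=> v w; case: (vxP v) => -[i ->]; rewrite ?inRy // inRx => /and3P[iW ij _].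
  case: (vxP w) => -[b ->] bW; rewrite ?exx // !exy => /andP[ab bt].
  rewrite (leq_trans ij (jmin _ bW)) (leq_trans bt) //.
  exact: t_mono (amin _ iW).
have dZ1 : [disjoint Z & W :\: R] by apply: disjointWr dZW; apply: subsetDl.
apply: (@leaf_acyclic k _ e e_sym e_irr _ Z D (vx a) (vy j)) => //.
- by rewrite inE inRx eqxx !andbF.
- by rewrite inE inRy.
- by rewrite eq_sym vxy.
- move=> w; case: (vxP w) => -[i ->]; rewrite ?eyy // inE inRx eyx => /andP[ni iW] /andP[ij _].
  by move: ni; rewrite iW ij /= negbK => /eqP ->.
set W' := del_nbhd _ _ _.
have W'x i : (vx i \in W') = (vx i \in W) && (j < i).
  rewrite 2!inE inRx exx andbT (inj_eq vx_inj).
  case iW: (vx i \in W); rewrite ?andbF //= andbT.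
  case: eqP => [->|_]; rewrite ?andbF ?andbT /=; last by rewrite ltnNge.
  by symmetry; apply/negbTE; rewrite -leqNgt; case/andP: aj.
have W'y b : (vy b \in W') = (vy b \in W) && (t a <= b).
  rewrite 2!inE inRy exy eq_sym vxy /=; case: (boolP (vy b \in W)) => //= bW.
  case/andP: aj => aj _; rewrite (leq_trans aj (jmin _ bW)) /=.
  by rewrite -leqNgt.
have dW' : [disjoint vx a |: Z & W'] by apply: disjoint_del_nbhd.
clearbody W'; apply: (next a j) => //.
- by move=> i; rewrite W'x.
- by move=> b; rewrite W'y.
- rewrite (card_xy W) (card_xy W').
  have cx : #|[set i | vx i \in W]| <= #|[set i | vx i \in W']| + (j.+1 - a).
    rewrite -(@card_ord_range m a j.+1) //; apply: leq_trans (leq_card_setU _ _).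
    apply: subset_leq_card; apply/subsetP => i; rewrite !inE => iW.
    by rewrite W'x iW ltnS amin //=; case: leqP.
  have cy : #|[set b | vy b \in W]| <= #|[set b | vy b \in W']| + (t a - j).
    rewrite -(@card_ord_range m j (t a)) //; apply: leq_trans (leq_card_setU _ _).
    apply: subset_leq_card; apply/subsetP => b; rewrite !inE => bW.
    by rewrite W'y bW jmin //=; case: leqP.
  by move: cx cy aj; clear; lia.
Qed.

Variables (s mus : nat).
Hypothesis mus_le : mus <= m.
Hypothesis t_top : forall a : 'I_m, s <= a -> t a = m.
Hypothesis t_ge : forall a, s <= t a.
Hypothesis t_drop : forall a : 'I_m, a < s -> t a + mus + s <= (m + a).+1.

(** Here c counts the rounds.  A round starting at a is followed by another one
    only if a < s, since otherwise t a = m and no y_b is left.  The third round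
    starts beyond t a_1 >= s; hence it is the last one, and its loss, at most
    m - t a_1, compensates the term t a_1 in the loss of the first. *)
Lemma staircase_acyclic W Z D : [disjoint Z & W] ->
  (forall c, c <= 3 -> #|W| <= 2 * m - (mus + s) + c -> ~~ D (#|Z| + c)) ->
  acyclic k (indep_fam e W Z) D.
Proof.
have cZ a (V Y : {set 'I_(m + m)}) : [disjoint Y & V] -> vx a \in V -> #|vx a |: Y| = #|Y|.+1.
  by move=> d aV; rewrite cardsU1 (disjoint_notin d aV).
move=> d1 nD.
have [W0|W0] := eqVneq W set0.
  rewrite W0; apply: indep_fam_set0_acyclic; rewrite -[X in D X]addn0; apply: nD => //.
  by rewrite W0 cards0.
apply: (staircase_step W0 d1) => {W0} a1 j1 W1 a1W j1W aj1 x1 y1 c1 d2.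
have e1 := cZ _ _ _ d1 a1W.
have tl1 := t_le a1.
have [W0|W0] := eqVneq W1 set0.
  rewrite W0 in c1 *; apply: indep_fam_set0_acyclic; rewrite e1 -addn1; apply: nD => //.
  move: c1; rewrite cards0; have la1 := ltn_ord a1.
  have [l1|l1] := ltnP a1 s; first by have := t_drop l1; lia.
  by have := t_top l1; lia.
apply: (staircase_step W0 d2) => {W0} a2 j2 W2 a2W j2W aj2 x2 y2 c2 d3.
have /andP[_ ja2] := x1 _ a2W; have /andP[_ tj2] := y1 _ j2W.
have lj2 := ltn_ord j2.
have [l1|/t_top ta] := ltnP a1 s; last by rewrite ta leqNgt lj2 in tj2.
have dr1 := t_drop l1; have tl2 := t_le a2.
have e2 := cZ _ _ _ d2 a2W.
have [W0|W0] := eqVneq W2 set0.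
  rewrite W0 in c2 *; apply: indep_fam_set0_acyclic; rewrite e2 e1 -addn2; apply: nD => //.
  move: c1 c2 dr1 tl2 ja2 aj1 aj2; rewrite cards0; clear; lia.
apply: (staircase_step W0 d3) => {W0} a3 j3 W3 a3W j3W aj3 x3 y3 c3 d4.
have /andP[a3W1 ja3] := x2 _ a3W; have /andP[_ tj3] := y2 _ j3W.
have lj3 := ltn_ord j3.
have [l2|/t_top ta] := ltnP a2 s; last by rewrite ta leqNgt lj3 in tj3.
have dr2 := t_drop l2; have ge1 := t_ge a1.
have top3 : t a3 = m by apply: t_top; move: ge1 tj2 aj2 ja3; clear; lia.
have e3 := cZ _ _ _ d3 a3W.
have [W0|W0] := eqVneq W3 set0.
  rewrite W0 in c3 *; apply: indep_fam_set0_acyclic.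
  rewrite e3 e2 e1 -addn3; apply: nD => //.
  move: c1 c2 c3 dr1 dr2 ge1 ja2 ja3 tj2 aj1 aj2 aj3 top3; rewrite cards0; clear; lia.
apply: (staircase_step W0 d4) => {W0} a4 j4 W4 _ j4W.
by have /andP[_] := y3 _ j4W; rewrite top3 leqNgt ltn_ord.
Qed.

Hypothesis s_gt1 : 1 < s < m.
Variables (x0 xs : 'I_m).
Hypotheses (x0E : x0 = 0 :> nat) (xsE : xs = s.-1 :> nat).
Hypothesis t_x0_lt : t x0 < t xs.
Hypothesis t_xs : t xs + mus = m.
Hypothesis mus_gt0 : 0 < mus.

(** W is the union of three disjoint stars: x_0 with the y_b for b < s - 1, x_(s-1)
    with the y_b for s - 1 <= b < t (s-1), and y_(m-1) with the x_i for i >= s.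
    When links are taken at the centres in the order x_0, y_(m-1), x_(s-1), each
    centre has at its turn a leaf attached to nothing else. *)
Lemma staircase_not_acyclic : exists2 W : {set 'I_(m + m)},
  #|W| = 2 * m - (mus + s) + 3 & forall Z D, [disjoint Z & W] ->
  D (#|Z| + 3) -> ~~ D (#|Z| + 4) -> ~ acyclic k (indep_fam e W Z) D.
Proof.
have lm : m.-1 < m by move: s_gt1; clear; lia.
have lt0 : t xs - 1 < m by move: s_gt1 t_xs; clear; lia.
pose xl : 'I_m := Ordinal lm; pose yt : 'I_m := Ordinal lt0.
pose W := [set v : 'I_(m + m) | match split v with
  | inl a => (a == 0 :> nat) || (s.-1 <= a)
  | inr b => (b < t xs) || (b == m.-1 :> nat) end].
have Wx a : (vx a \in W) = (a == 0 :> nat) || (s.-1 <= a).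
  by rewrite inE -[vx a]/(unsplit (inl a)) unsplitK.
have Wy b : (vy b \in W) = (b < t xs) || (b == m.-1 :> nat).
  by rewrite inE -[vy b]/(unsplit (inr b)) unsplitK.
clearbody W; exists W.
  rewrite card_xy.
  have -> : [set a | vx a \in W] = x0 |: [set i : 'I_m | s.-1 <= i < m].
    by apply/setP => a; rewrite !inE Wx ltn_ord andbT -val_eqE /= x0E.
  have -> : [set b | vy b \in W] = xl |: [set i : 'I_m | 0 <= i < t xs].
    by apply/setP => b; rewrite !inE Wy orbC.
  rewrite !cardsU1 !inE !card_ord_range //= x0E.
  by move: s_gt1 t_xs mus_gt0; clear; lia.
move=> Z D dZ D3 D4 aW.
have tx0s := t_ge x0.
(* In W, the only neighbour of y_0 is x_0. *)
pose W1 := del_nbhd e W (vx x0).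
have a1 : acyclic k (indep_fam e W1 (vx x0 |: Z)) D.
  apply: (@leaf_unlink k _ e e_sym e_irr W Z _ (vx x0) (vy x0)) aW => //.
  - by rewrite Wx x0E.
  - by rewrite Wy x0E; move: t_x0_lt; clear; lia.
  - by rewrite eq_sym vxy.
  - move=> w; case: (vxP w) => -[i ->] _; rewrite ?eyy // eyx => /andP[i0 _].
    by congr vx; apply: val_inj; move: i0; rewrite /= x0E; clear; lia.
have W1x a : (vx a \in W1) = (vx a \in W) && (a != 0 :> nat).
  by rewrite inE exx andbT (inj_eq vx_inj) -val_eqE /= x0E.
have W1y b : (vy b \in W1) = (vy b \in W) && (t x0 <= b).
  by rewrite inE exy eq_sym vxy x0E /= -leqNgt.
have d1 : [disjoint vx x0 |: Z & W1] by apply: disjoint_del_nbhd.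
(* The only neighbour of x_(m-1) is y_(m-1). *)
clearbody W1; pose W2 := del_nbhd e W1 (vy xl).
have a2 : acyclic k (indep_fam e W2 (vy xl |: (vx x0 |: Z))) D.
  apply: (@leaf_unlink k _ e e_sym e_irr W1 _ _ (vy xl) (vx xl)) a1 => //.
  - by rewrite W1y Wy eqxx orbT /=; move: t_x0_lt t_xs; clear; lia.
  - by rewrite W1x Wx /=; move: s_gt1; clear; lia.
  - by rewrite vxy.
  - move=> w; case: (vxP w) => -[i ->] _; rewrite ?exx // exy /= => /andP[i0 _].
    by congr vy; apply: val_inj; move: i0 (ltn_ord i) => /=; clear; lia.
have W2x a : (vx a \in W2) = (vx a \in W1) && (a < s).
  rewrite inE eyx vxy /=; congr andb; have la := ltn_ord a.
  have [l1|l1] := ltnP a s; last first.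
    by rewrite (t_top l1) /=; move: la; clear; lia.
  have tl : t a <= t xs by apply: t_mono; move: l1; rewrite xsE; clear; lia.
  by move: tl t_xs mus_gt0; clear; lia.
have W2y b : (vy b \in W2) = (vy b \in W1) && (b != m.-1 :> nat).
  by rewrite inE eyy andbT (inj_eq vy_inj) -val_eqE.
have d2 : [disjoint vy xl |: (vx x0 |: Z) & W2] by apply: disjoint_del_nbhd.
(* The vertex y_b with b = t (s-1) - 1 >= t 0 has escaped from x_0, and the x_i
   with i >= s are gone with y_(m-1). *)
clearbody W2; pose W3 := del_nbhd e W2 (vx xs).
have a3 : acyclic k (indep_fam e W3 (vx xs |: (vy xl |: (vx x0 |: Z)))) D.
  apply: (@leaf_unlink k _ e e_sym e_irr W2 _ _ (vx xs) (vy yt)) a2 => //.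
  - by rewrite W2x W1x Wx xsE; move: s_gt1; clear; lia.
  - by rewrite W2y W1y Wy /=; move: t_x0_lt t_xs mus_gt0; clear; lia.
  - by rewrite eq_sym vxy.
  - move=> w; case: (vxP w) => -[i ->]; rewrite ?eyy // W2x W1x Wx => ii _.
    by congr vx; apply: val_inj; move: ii; rewrite /= xsE; clear; lia.
have W30 : W3 = set0.
  apply/setP => v; rewrite !inE; apply/negP => /and3P[].
  case: (vxP v) => -[i ->].
    by rewrite W2x W1x Wx (inj_eq vx_inj) -val_eqE /= xsE; clear; lia.
  by rewrite W2y W1y Wy exy xsE; move: tx0s; clear; lia.
have c1 : vx x0 \notin Z by apply: disjoint_notin dZ _; rewrite Wx x0E.
have c2 : vy xl \notin vx x0 |: Z.
  apply: disjoint_notin d1 _; rewrite W1y Wy eqxx orbT /=.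
  by move: t_x0_lt t_xs; clear; lia.
have c3 : vx xs \notin vy xl |: (vx x0 |: Z).
  by apply: disjoint_notin d2 _; rewrite W2x W1x Wx xsE; move: s_gt1; clear; lia.
have cZ : #|vx xs |: (vy xl |: (vx x0 |: Z))| = #|Z| + 3.
  by rewrite cardsU1 c3 cardsU1 c2 cardsU1 c1 addn3.
move: a3; rewrite W30; by apply: indep_fam_set0_not_acyclic; rewrite cZ // -addnS.
Qed.

End Staircase.

(** * The initial-closed graph of a closed graph *)

Section ClosedGraph.
Variables (n : nat) (G : rel 'I_n).
Hypotheses (G_sym : ssrbool.symmetric G) (G_conn : connected_graph G).
Hypothesis G_closed : closed_graph G.
Implicit Types u v w i j : 'I_n.

Definition ascending : rel 'I_n := fun u v => G u v && (u < v).

Lemma ascending_le u v : connect ascending u v -> u <= v.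
Proof.
move=> /connectP[p]; elim: p u => [|x p IH] u /=; first by move=> _ ->.
by move=> /andP[/andP[_ ux] /IH h] /h; apply: leq_trans; apply: ltnW.
Qed.

(** If a walk goes up to v and then down to w, closedness joins w to the vertex
    before v, which shortens the walk. *)
Lemma ascending_step_down u v w : connect ascending u v -> G v w -> w < v ->
  connect ascending u w || connect ascending w u.
Proof.
move=> /connectP[p]; elim/last_ind: p v => [|p x IH] v /=.
  by move=> _ -> uw wu; rewrite [connect _ w u]connect1 ?orbT // /ascending G_sym uw.
rewrite rcons_path last_rcons => /andP[pp /andP[gx ltx]] -> {v} xw wx.
set y := last u p in gx ltx; have uy : connect ascending u y by apply/connectP; exists p.
have [->|ne] := eqVneq w y; first by rewrite uy.
have yw : G y w.
  by apply: (@G_closed x y w) => //; rewrite 1?eq_sym // 1?G_sym // ltx wx orbT.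
have [lt|gt|eq] := ltngtP y w.
- by rewrite (connect_trans uy) // connect1 // /ascending yw.
- exact: IH pp (erefl _) yw gt.
- by rewrite (val_inj eq) eqxx in ne.
Qed.

Lemma ascending_step_up u v w : connect ascending v u -> G v w -> v < w ->
  connect ascending u w || connect ascending w u.
Proof.
move=> /connectP[p]; elim: p v => [|x p IH] v /=.
  by move=> _ -> uw wu; rewrite connect1 // /ascending uw.
move=> /andP[/andP[gx ltx] pp] eu vw ltw.
have xu : connect ascending x u by apply/connectP; exists p.
have [->|ne] := eqVneq w x; first by rewrite xu orbT.
have xw : G x w by apply: (@G_closed v x w) => //; rewrite 1?eq_sym // ltx ltw.
have [lt|gt|eq] := ltngtP x w.
- exact: (IH x).
- by rewrite [connect _ w u](connect_trans _ xu) ?orbT // connect1 // /ascending G_sym xw.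
- by rewrite (val_inj eq) eqxx in ne.
Qed.

(** In a connected closed graph, peaks and valleys of a walk can be cut off, so any
    two vertices are joined by a monotone path. *)
Lemma ascending_total u w : connect ascending u w || connect ascending w u.
Proof.
have /connectP[p pp ->] := G_conn u w.
elim/last_ind: p pp => [|p x IH] /=; first by rewrite connect0.
rewrite rcons_path last_rcons => /andP[/IH + gx]; set y := last u p in gx *.
have [lt|gt|eq] := ltngtP y x; last by rewrite (val_inj eq).
  case/orP=> [uy|yu]; last exact: ascending_step_up yu gx lt.
  by rewrite (connect_trans uy) // connect1 // /ascending gx.
case/orP=> [uy|yu]; first exact: ascending_step_down uy gx gt.
rewrite [connect _ x u](connect_trans _ yu) ?orbT // connect1 // /ascending G_sym gx //.
Qed.

(** A monotone path has no room between consecutive vertices. *)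
Lemma closed_consecutive u w : w = u.+1 :> nat -> G u w.
Proof.
move=> e; have := ascending_total u w; case/orP => [|/ascending_le]; last by rewrite e ltnn.
move=> /connectP[[|x p] /=]; first by move=> _ eu; move: e; rewrite eu => /n_Sn.
move=> /andP[/andP[gx ltx] pp] ew.
have /ascending_le : connect ascending x w by apply/connectP; exists p.
by rewrite e => xu; rewrite (_ : w = x) //; apply: val_inj; apply/eqP; rewrite /= e eqn_leq xu ltx.
Qed.

(** The vertices i and j - 1 both lie below j and are adjacent to j, hence to each
    other; this step is repeated down to v. *)
Lemma closed_interval i j v : G i j -> i < v -> v <= j -> G i v.
Proof.
move: {2}(j - v) (erefl (j - v)) => d; elim: d j => [|d IH] j.
  by move=> e gij _ vj; rewrite (_ : v = j) //; apply: val_inj => /=; move: e vj; lia.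
move=> e gij iv vj.
have lj : j.-1 < n by have := ltn_ord j; lia.
pose j' := Ordinal lj.
apply: (IH j') => //=; [by move: e; lia | | by move: e; lia].
apply: (@G_closed j i j').
- by rewrite -val_eqE /=; move: e iv; lia.
- by rewrite G_sym.
- by rewrite G_sym; apply: closed_consecutive; rewrite /=; move: e iv; lia.
- by rewrite /=; move: e iv; lia.
Qed.

Lemma initial_xyP (a b : 'I_n.-1) :
  reflect (exists i j : 'I_n, [/\ i = a :> nat, j = b.+1 :> nat, i < j & G i j])
    (initial_xy G a b).
Proof.
apply: (iffP existsP) => [[i /existsP[j /and4P[/eqP ? /eqP ? ? ?]]]|[i [j [ia jb ij gij]]]].
  by exists i, j.
by exists i; apply/existsP; exists j; rewrite ia jb !eqxx -ia -jb ij gij.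
Qed.

Lemma initial_interval (a b c : 'I_n.-1) : initial_xy G a b -> a <= c <= b -> initial_xy G a c.
Proof.
move=> /initial_xyP[i [j [ia jb ij gij]]] /andP[ac cb].
have l2 : c.+1 < n by have := ltn_ord c; lia.
apply/initial_xyP; exists i, (Ordinal l2); split=> //=; rewrite ?ia ?ltnS //.
by apply: (closed_interval gij); rewrite /= ?ia ?jb ?ltnS.
Qed.

Local Notation H := (initial_closed_graph G).

Lemma split_vx m (a : 'I_m) : split (vx a) = inl a.
Proof. exact: (unsplitK (inl a)). Qed.

Lemma split_vy m (b : 'I_m) : split (vy b) = inr b.
Proof. exact: (unsplitK (inr b)). Qed.

Lemma initial_closed_xy a b : H (vx a) (vy b) = initial_xy G a b.
Proof. by rewrite /initial_closed_graph split_vx split_vy. Qed.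

Lemma initial_closed_xx a b : H (vx a) (vx b) = false.
Proof. by rewrite /initial_closed_graph !split_vx. Qed.

Lemma initial_closed_yy a b : H (vy a) (vy b) = false.
Proof. by rewrite /initial_closed_graph !split_vy. Qed.

Lemma initial_closed_sym : ssrbool.symmetric H.
Proof. by move=> u v; rewrite /initial_closed_graph; case: split; case: split. Qed.

Lemma initial_closed_irr : irreflexive H.
Proof. by move=> u; rewrite /initial_closed_graph; case: split. Qed.

Lemma degree_initial a : degree H (vx a) = #|[set b | initial_xy G a b]|.
Proof.
rewrite /degree card_xy [X in X + _](_ : _ = 0) ?add0n.
  by apply: eq_card => b; rewrite !inE initial_closed_xy.
by apply/eqP; rewrite cards_eq0; apply/eqP/setP => b; rewrite !inE initial_closed_xx.
Qed.

Lemma initial_le (a b : 'I_n.-1) : initial_xy G a b -> a <= b.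
Proof. by move=> /initial_xyP[i [j [ia jb]]]; rewrite ia jb ltnS. Qed.

(** The neighbours of x_a form an interval of y-indices starting at a, so they are
    determined by their number. *)
Lemma initial_mu (a b : 'I_n.-1) : initial_xy G a b = (a <= b < n.-1 - mu_entry H a).
Proof.
have la := ltn_ord a; have lb := ltn_ord b.
set S := [set b | initial_xy G a b].
have Sm : #|S| <= n.-1 - a.
  rewrite -(@card_ord_range n.-1 a n.-1) //; apply: subset_leq_card.
  by apply/subsetP => c; rewrite !inE ltn_ord andbT; apply: initial_le.
have -> : n.-1 - mu_entry H a = a + #|S|.
  by rewrite /mu_entry degree_initial -/S; move: Sm la; clear; lia.
apply/idP/andP => [ab|[ab bS]].
  split; first exact: initial_le.
  have : #|[set c : 'I_n.-1 | a <= c < b.+1]| <= #|S|.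
    by apply: subset_leq_card; apply/subsetP => c; rewrite !inE ltnS; apply: initial_interval.
  by rewrite card_ord_range // => h; have := initial_le ab; move: h; clear; lia.
apply: contraLR bS => nab; rewrite -leqNgt.
have : #|S| <= #|[set c : 'I_n.-1 | a <= c < b]|.
  apply: subset_leq_card; apply/subsetP => c; rewrite !inE => ac.
  rewrite (initial_le ac) /= ltnNge; apply: contra nab => bc.
  by apply: initial_interval ac _; rewrite ab bc.
by rewrite card_ord_range ?(ltnW lb) // => h; move: h ab; clear; lia.
Qed.

End ClosedGraph.

(** A nonzero entry at the corner of the region i <= p, j <= i + 3 dominates every
    other entry of the region. *)
Lemma extremal_of_corner (beta : nat -> nat -> nat) p :
  beta p (p + 3) <> 0 ->
  (forall i j, beta i j <> 0 -> i <= p /\ j <= i + 3) ->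
  unique_extremal_betti beta p (p + 3).
Proof.
move=> np bound; split.
  split=> // l r pl jr h; apply/eqP/negPn/negP => /eqP /bound[]; lia.
move=> i j [nz ext]; have [ip ji] := bound i j nz.
have [e|ne] := eqVneq j (p + 3); first by split=> //; lia.
by case: np; apply: ext; lia.
Qed.

Theorem corollary3p9 (k : fieldType) (n : nat) (G : rel 'I_n)
    (hn : 2 <= n)
    (Gsimple : simple_graph G)
    (Gconnected : connected_graph G)
    (Gclosed : closed_graph G)
    (Gnocut : forall v : 'I_n, ~ cut_point G v)
    (s : nat) (hs : 1 <= s <= n - 3)
    (mu : nat -> nat)
    (* mu(H) = (mu_1, ..., mu_s, 0, ..., 0) *)
    (hmu : forall a : 'I_n.-1,
      mu_entry (initial_closed_graph G) a = if a.+1 <= s then mu a.+1 else 0)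
    (* 0 < mu_s < ... < mu_1 < n - s.  The ends of the chain are mu_s < mu_1,
       which excludes s = 1: the conclusion fails there, e.g. for the path on
       six vertices (n = 4, mu = (1, 0, 0)), whose Betti number in degree
       (4, 7) is zero. *)
    (mu_pos : 0 < mu s)
    (mu_decr : forall i : nat, 1 <= i < s -> mu i.+1 < mu i)
    (mu_ends : mu s < mu 1)
    (mu_ub : mu 1 < n - s)
    (F : min_graded_free_resolution
           (@edge_ideal k _ (initial_closed_graph G))) :
  unique_extremal_betti (graded_betti F)
    (2 * (n - 1) - (mu s + s)) (2 * (n - 1) - (mu s + s) + 3).
Proof.
have [G_sym _] := Gsimple.
set H := initial_closed_graph G in hmu F *.
have H_sym : ssrbool.symmetric H := @initial_closed_sym n G.
have H_irr : irreflexive H := @initial_closed_irr n G.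
pose m := n.-1; have e_m : n - 1 = m by rewrite subn1.
pose t (a : 'I_m) := m - mu_entry H a.
have Hxy a b : H (vx a) (vy b) = (a <= b < t a).
  by rewrite /H initial_closed_xy initial_mu.
have drop i j : 1 <= i -> i <= j -> j <= s -> mu j + (j - i) <= mu i.
  move=> i1 ij js; have [d e] : exists d, j = i + d by exists (j - i); rewrite subnKC.
  elim: d j e {ij} js => [|d IH] j -> js; first by rewrite addn0 subnn addn0.
  move: js; rewrite addnS => js.
  by have := IH (i + d) (erefl _); have := mu_decr (i + d); move: js i1; clear; lia.
have mu_le i : 1 <= i -> i <= s -> mu i <= m - s.
  by move=> i1 is_; have := drop 1 i isT i1 is_; move: mu_ub; rewrite /m; clear; lia.
have tE (a : 'I_m) : t a = m - (if a < s then mu a.+1 else 0) by rewrite /t hmu.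
have t_mono (a b : 'I_m) : a <= b -> t a <= t b.
  rewrite !tE => ab; have := drop a.+1 b.+1 isT ab.
  have [bs /(_ isT)|bs _] := ltnP b s; last by move: (mu _); clear; lia.
  by rewrite (leq_ltn_trans ab bs); clear; lia.
have t_le a : t a <= m by rewrite leq_subr.
have t_top (a : 'I_m) : s <= a -> t a = m by rewrite tE ltnNge => ->; rewrite subn0.
have t_ge a : s <= t a.
  rewrite tE; have := mu_le a.+1 isT; case: ifP => [_ /(_ isT)|_ _].
    by move: hs hn; rewrite /m; clear; lia.
  by move: hs; rewrite /m; clear; lia.
have t_drop (a : 'I_m) : a < s -> t a + mu s + s <= (m + a).+1.
  move=> as_; rewrite tE as_; have := drop a.+1 s isT as_ (leqnn _).
  have := mu_le a.+1 isT as_; move: as_ (ltn_ord a) hs; rewrite /m; clear; lia.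
have s_gt1 : 1 < s < m.
  have s1 : s != 1 by apply: contraTneq mu_ends => ->; rewrite ltnn.
  by move: hs hn s1; rewrite /m; clear; lia.
have mus_le : mu s <= m.
  by have := mu_le s _ (leqnn _); move: s_gt1; clear; lia.
have H_up := @covers_up _ H.
have IP := @edge_idealP k _ H H_irr.
set p := _ - _; apply: extremal_of_corner => [b0|i j].
  have l0 : 0 < m by move: s_gt1; clear; lia.
  have l1 : s.-1 < m by move: s_gt1; clear; lia.
  pose x0 : 'I_m := Ordinal l0; pose xs : 'I_m := Ordinal l1.
  have txs : t xs + mu s = m.
    rewrite tE /= (_ : s.-1 < s) ?prednK ?subnK //; by move: s_gt1; clear; lia.
  have tx0 : t x0 < t xs.
    rewrite [t x0]tE /= (_ : 0 < s) //; last by move: s_gt1; clear; lia.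
    by move: txs mu_ends mu_ub; rewrite /m; clear; lia.
  have [W cW nac] := staircase_not_acyclic k H_sym H_irr Hxy
    (@initial_closed_xx n G) (@initial_closed_yy n G) t_mono t_le t_top t_ge
    s_gt1 (x0 := x0) (xs := xs) (erefl _) (erefl _) tx0 txs mu_pos.
  have cp : #|W| = p + 3 by rewrite cW /p e_m.
  have cC := cardsC W; rewrite card_ord in cC.
  apply: (nac (~: W) (fun q => q + p == n.-1 + n.-1)).
  - by rewrite -setI_eq0 setIC setICr.
  - by move: cC; rewrite cp; clear; lia.
  - by move: cC; rewrite cp; clear; lia.
  have ew : [set i | 0 < mnm_set W i] = W by apply/setP => i; rewrite inE mnmE; case: (i \in W).
  apply: (eq_acyclic (P := strand (covers H) (mnm_set W))).
    by move=> B; rewrite strand_indep_fam ?ew // => i; rewrite mnmE; case: (i \in W).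
  by apply: (betti_eq0_acyclic H_up IP b0); rewrite mdeg_mnm_set.
move=> b0; have [/andP[-> ->]//|nb] := boolP ((i <= p) && (j <= i + 3)).
case: b0; apply: (betti_eq0 H_up IP) => a aj.
apply: strand_acyclic => W cW.
apply: (staircase_acyclic H_sym H_irr Hxy (@initial_closed_xx n G)
  (@initial_closed_yy n G) t_mono t_le mus_le t_top t_ge t_drop).
  by rewrite -setI_eq0 setIC setICr.
move=> c c3; have cC := cardsC W; rewrite card_ord in cC.
move=> Wc; apply: contra nb => /eqP.
by move: cC Wc c3; rewrite cW aj /p e_m; clear; lia.
Qed.
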